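(* Let $q$ be a prime, let $P=\mathbf{F}_q[x_n,\ldots,x_1]$, let $A$ be an affine domain that is an integral extension of $P$, and let $\overline{A}$ be the integral closure of $A$ in its field of fractions. Let $I$ be an ideal of $\overline{A}$. For all sufficiently large $e$ (depending on $I$), with $Q:=q^e$ and $\phi_Q$ the operation on ideals of $\overline{A}$ given by the Qth-power algorithm, there is an integer $k\geq 1$ such that \[ I\subseteq \phi_Q(I)\subseteq\cdots\subseteq (\phi_Q)^k(I)=(\phi_Q)^{k+1}(I)=C(I,\overline{A}),\] where $C(I,\overline{A})$ is the integral closure of the ideal $I$ in $\overline{A}$.
   Context: $\mathbf{F}_q$ is the field with $q$ elements. $A=R/J$, where $R=P[y_m,\ldots,y_1]$ is a polynomial ring over $P$ and $J$ is an ideal of $R$ such that $A$ is a domain containing $P$ in which every element satisfies a monic polynomial with coefficients in $P$ (so $P$ is a Noether normalization of $A$). An element $z\in\overline{A}$ is integral over $I$ iff it is a root of some monic polynomial $T^d+a_1T^{d-1}+\cdots+a_d\in\overline{A}[T]$ with $a_j\in I^j$ for $1\leq j\leq d$; $C(I,\overline{A})$ is the set of all such $z$. Qth-power algorithm: for an ideal $I'$ of $\overline{A}$ and $Q=q^e$, put $M_0(I'):=\overline{A}$ and \[ M_{i+1}(I'):=\{g\in M_i(I')\ :\ g^Q\in M_i(I')^{Q-1}I'\}\quad (i\geq 0),\] where $M_i(I')^{Q-1}I'$ is the set of all finite sums of products $m_1\cdots m_{Q-1}\,h$ with $m_1,\ldots,m_{Q-1}\in M_i(I')$ and $h\in I'$.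 Then $\phi_Q(I')$ is the stable value $M_L(I')=M_{L+1}(I')$ of this descending sequence. $(\phi_Q)^k$ denotes the $k$-fold iterate of $\phi_Q$. *)

(* Defs.v *)
From HB Require Import structures.
From mathcomp Require Import all_boot all_order all_algebra.
From mathcomp Require Import boolp classical_sets.
From mathcomp Require Import mpoly.

Set Implicit Arguments.
Unset Strict Implicit.
Unset Printing Implicit Defensive.

Import GRing.Theory.
Local Open Scope ring_scope.
Local Open Scope classical_set_scope.

Definition integral_closure (A : idomainType) : set {fraction A} :=
  [set z | integralOver (@tofrac A) z].
Arguments integral_closure A : clear implicits.

(* Below, [B] is a subring of [K], given as a set; its ideals are sets of
   elements of [K] as well. *)
Section Ideals.
Variables (K : comNzRingType) (B : set K).

(* Closure under opposites follows from [ideal_mull], since -1 is in [B]. *)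
Record is_ideal (I : set K) : Prop := IsIdeal {
  ideal_sub : I `<=` B;
  ideal0 : I 0;
  idealD : forall x y, I x -> I y -> I (x + y);
  ideal_mull : forall b x, B b -> I x -> I (b * x)
}.

(* M^r H: the finite sums of products m_1 ... m_r h. *)
Definition ideal_expM (M : set K) (r : nat) (H : set K) : set K :=
  [set z | exists (s : nat) (m : 'I_s -> 'I_r -> K) (h : 'I_s -> K),
     [/\ forall i j, M (m i j), forall i, H (h i)
       & z = \sum_(i < s) (\prod_(j < r) m i j) * h i]].

(* I^r as an ideal of [B]; the last factor makes I^0 = B. *)
Definition ideal_exp (I : set K) (r : nat) : set K := ideal_expM I r B.

(* p = T^d + a_1 T^(d-1) + ... + a_d, with a_j = p`_(d - j) in I^j. *)
Definition ideal_integral_closure (I : set K) : set K :=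
  [set z | B z /\ exists (d : nat) (p : {poly K}),
     [/\ p \is monic, size p = d.+1,
         forall i, B p`_i,
         forall j : nat, (1 <= j <= d)%N -> ideal_exp I j p`_(d - j)
       & root p z]].

Fixpoint Qpower_seq (Q : nat) (I : set K) (i : nat) : set K :=
  if i is i'.+1 then
    [set g | Qpower_seq Q I i' g /\
             ideal_expM (Qpower_seq Q I i') (Q - 1)%N I (g ^+ Q)]
  else B.

(* The stable value of [Qpower_seq Q I]. Each term determines the next one, so
   the sequence is constant from any index L with M_L = M_(L+1) on, and the
   value M_L does not depend on L. If there is no such L the result is set0,
   which is never an ideal: hence any statement giving an element of
   [Qpower Q I] includes that the sequence stabilizes. *)
Definition Qpower (Q : nat) (I : set K) : set K :=
  [set g | exists L : nat,
     Qpower_seq Q I L = Qpower_seq Q I L.+1 /\ Qpower_seq Q I L g].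

End Ideals.

(* Main.v *)
Require Import Defs.
From HB Require Import structures.
From mathcomp Require Import all_boot all_order all_algebra.
From mathcomp Require Import boolp classical_sets.
From mathcomp Require Import mpoly ring zify.

Set Implicit Arguments.
Unset Strict Implicit.
Unset Printing Implicit Defensive.

Import GRing.Theory.
Local Open Scope ring_scope.
Local Open Scope classical_set_scope.

(** Write [B] for the integral closure of [A], [K] for its field of fractions,
    [C(I)] for the integral closure of an ideal [I] of [B], and [t] for a
    variable. The theorem holds with [k = 1]: for [Q = q^e] large enough,
    [phi_Q(I) = C(I)]; since [C(C(I)) = C(I)], applying this to the ideal [C(I)]
    gives [phi_Q(phi_Q(I)) = phi_Q(I)].

    The proof rests on an integral extension of a polynomial ring. For suitable
    [g_1, .., g_r] in [I] the ring [A[1/t, g_1 t, .., g_r t]] is a finitely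
    generated algebra over a field, so it is integral over a polynomial ring [R]
    inside it ([noether_normalization]). Let [O] be the integral closure of [R]
    in [K(t)]. If the [g_i] are well chosen, then an element [g] of [K] lies in
    [C(I)] if and only if [g t] lies in [O] ([closureE]). In one direction, an
    integral equation of [g t] over [R] is an equation over the extended Rees
    ring [B[I t, 1/t]], whose homogeneous component of top degree is an equation
    of [g] over [I] ([rees_equation]).

    Two uniform properties of [O] are needed ([uniform_integrality]): there is
    an [m] such that each element of [O] satisfies a monic equation of degree
    [m] over [R]; and for each nonzero [u] in [O] there is a power [N] of [q]
    such that [u w^N] in [O] implies [w] in [O]. The second one replaces the
    discreteness of the Rees valuations of [I]. It holds for [R] by unique
    factorization, here in the form [frob_closed]. To pass to [O], represent
    [w] by its matrix in a basis of [K(t)] over the field of fractions of [R]: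
    as the characteristic is [q], the characteristic polynomial of [w^N] has the
    [N]th powers of the coefficients of that of [w] as coefficients
    ([char_poly_frob]), so that everything reduces to elements of that field.

    From the first property, for [g] in [C(I)] and [Q >= m] the equation of
    degree [m] of [g] gives that [g^Q] lies in [C(I)^(Q-1) I]
    ([closure_reduction]); hence [C(I)] is contained in each term [M_i] of the
    descending sequence. From the second one, the sequence reaches [C(I)]: by
    induction on [i], each [g] in [M_i] satisfies that
    [(g t)^(Q^i) (1/t)^((Q-1)^i)] is in [O] ([Qpower_seq_rees]). As
    [(Q-1)^i / Q^i] tends to [0], the discreteness of [O] for [u = 1/t] yields
    that [g t] is in [O] once [i] is large ([Qpower_seq_sub_closure]).

    It remains to find the [g_i]: each [h t] with [h] in [I] has to be in [O],
    and for this it is enough that some power [h^N], with [N] a fixed power of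
    [q], is a combination of the [g_i^N] with coefficients in [A]
    ([finite_up_to_frobenius]). This follows from Hilbert's basis theorem for
    [A] and from the existence of a conductor up to Frobenius: a nonzero [d]
    such that [d b^N] is in [A] for each [b] in [B] ([frobenius_conductor]). The
    power [N] absorbs the inseparability of [K] over the field of fractions of
    [P]. *)

(** * Frobenius powers and fields of fractions *)
Section Frobenius.
Variables (q : nat) (R : comNzRingType) (charR : q \in [pchar R]).

Lemma frobD i (x y : R) : (x + y) ^+ (q ^ i) = x ^+ (q ^ i) + y ^+ (q ^ i).
Proof.
apply: exprDn_pchar; rewrite (eq_pnat _ (pcharf_eq charR)) pnatX pnat_id //.
exact: pcharf_prime charR.
Qed.

Lemma frobB i (x y : R) : (x - y) ^+ (q ^ i) = x ^+ (q ^ i) - y ^+ (q ^ i).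
Proof. by apply/(addIr (y ^+ (q ^ i))); rewrite -frobD !subrK. Qed.

Lemma frob_sum i (J : Type) (s : seq J) (P : pred J) (F : J -> R) :
  (\sum_(j <- s | P j) F j) ^+ (q ^ i) = \sum_(j <- s | P j) F j ^+ (q ^ i).
Proof.
apply: (big_morph (fun x => x ^+ (q ^ i)) (frobD i)).
by rewrite expr0n expn_eq0 eqn0Ngt prime_gt0 // (pcharf_prime charR).
Qed.
End Frobenius.

Lemma tofrac_inj (R : idomainType) : injective (@tofrac R).
Proof. by move=> a b /eqP; rewrite tofrac_eq => /eqP. Qed.

Lemma fracP (R : idomainType) (x : {fraction R}) :
  exists a b : R, b != 0 /\ x = tofrac a / tofrac b.
Proof.
elim/quotW: x => r; exists r.1, r.2.
have r2 := denom_ratioP r; split => //.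
apply: (@mulIf _ (tofrac r.2)); first by rewrite tofrac_eq0.
rewrite divfK ?tofrac_eq0 //; unlock tofrac.
rewrite -[LHS]FracField.pi_mul; apply/eqmodP; rewrite /= FracField.equivfE.
by rewrite /FracField.mulf !numden_Ratio ?mulr1 ?oner_neq0 //= mulrC.
Qed.

Section FracLift.
Variables (R : idomainType) (L : fieldType) (f : {rmorphism R -> L}).
Hypothesis f_inj : injective f.

(** The proof of injectivity is an argument so that the ring morphism structure
    of [frac_lift] can be inferred from the term. *)
Definition frac_lift (_ : injective f) (x : {fraction R}) : L :=
  let r := repr x in f r.1 / f r.2.

Lemma frac_liftE (a b : R) : b != 0 ->
  frac_lift f_inj (tofrac a / tofrac b) = f a / f b.
Proof.
move=> b0; set x := tofrac a / tofrac b; rewrite /frac_lift; set r := repr x.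
have fn0 (c : R) : c != 0 -> f c != 0.
  by move=> c0; rewrite -(rmorph0 f) (inj_eq f_inj).
have r20 : r.2 != 0 by exact: denom_ratioP.
have : x * tofrac r.2 = tofrac r.1.
  rewrite -[x]reprK -/r; unlock tofrac.
  rewrite -[LHS]FracField.pi_mul; apply/eqmodP; rewrite /= FracField.equivfE.
  by rewrite /FracField.mulf !numden_Ratio ?mulr1 ?oner_neq0 //= mulrC.
move=> /(congr1 ( *%R^~ (tofrac b))); rewrite /x mulrAC divfK ?tofrac_eq0 //.
rewrite -!rmorphM => /eqP; rewrite tofrac_eq => /eqP E.
apply: (@mulIf _ (f r.2 * f b)); first by rewrite mulf_neq0 ?fn0.
by rewrite mulrA divfK ?fn0 // (mulrC (f r.2)) mulrA divfK ?fn0 // -!rmorphM E.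
Qed.

Lemma frac_lift_tofrac a : frac_lift f_inj (tofrac a) = f a.
Proof.
by have := frac_liftE a (oner_neq0 R); rewrite !rmorph1 !divr1.
Qed.

Lemma frac_lift_is_zmod_morphism : zmod_morphism (frac_lift f_inj).
Proof.
move=> x y; have [a [b [b0 ->]]] := fracP x; have [c [d [d0 ->]]] := fracP y.
have fn0 (e : R) : e != 0 -> f e != 0.
  by move=> e0; rewrite -(rmorph0 f) (inj_eq f_inj).
rewrite -mulNr addf_div ?tofrac_eq0 // -rmorphN -!rmorphM -rmorphD.
rewrite !frac_liftE ?mulf_neq0 // -mulNr addf_div ?fn0 //.
by rewrite rmorphD !rmorphM rmorphN.
Qed.

Lemma frac_lift_is_monoid_morphism : monoid_morphism (frac_lift f_inj).
Proof.
split=> [|x y]; first by rewrite -tofrac1 frac_lift_tofrac rmorph1.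
have [a [b [b0 ->]]] := fracP x; have [c [d [d0 ->]]] := fracP y.
by rewrite mulf_div -!rmorphM !frac_liftE ?mulf_neq0 // !rmorphM mulf_div.
Qed.

HB.instance Definition _ := GRing.isZmodMorphism.Build {fraction R} L (frac_lift f_inj)
  frac_lift_is_zmod_morphism.
HB.instance Definition _ := GRing.isMonoidMorphism.Build {fraction R} L (frac_lift f_inj)
  frac_lift_is_monoid_morphism.
End FracLift.

(** * Rings closed under Frobenius roots with bounded denominator *)
Definition in_ring (R : idomainType) (z : {fraction R}) := exists a : R, z = tofrac a.

(** What is used of unique factorization: if [c z^N] is in [R] for a power [N]
    of [q] that exceeds all multiplicities of prime factors of [c], then no prime
    can divide the denominator of [z]. *)
Definition frob_closed (q : nat) (R : idomainType) := forall c : R, c != 0 ->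
  exists i0, forall i, (i0 <= i)%N -> forall z : {fraction R},
  in_ring (tofrac c * z ^+ (q ^ i)) -> in_ring z.

Section InRing.
Variable R : idomainType.
Implicit Types y z : {fraction R}.
Lemma in_ring_tofrac (a : R) : in_ring (tofrac a). Proof. by exists a. Qed.
Lemma in_ring0 : @in_ring R 0. Proof. by exists 0; rewrite tofrac0. Qed.
Lemma in_ringD y z : in_ring y -> in_ring z -> in_ring (y + z).
Proof. by move=> [a ->] [b ->]; exists (a + b); rewrite tofracD. Qed.
Lemma in_ringN y : in_ring y -> in_ring (- y).
Proof. by move=> [a ->]; exists (- a); rewrite tofracN. Qed.
Lemma in_ringM y z : in_ring y -> in_ring z -> in_ring (y * z).
Proof. by move=> [a ->] [b ->]; exists (a * b); rewrite tofracM. Qed.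
Lemma in_ringX y n : in_ring y -> in_ring (y ^+ n).
Proof. by move=> [a ->]; exists (a ^+ n); rewrite tofracXn. Qed.
Lemma in_ring_sum (J : Type) (s : seq J) (P : pred J) (F : J -> {fraction R}) :
  (forall j, P j -> in_ring (F j)) -> in_ring (\sum_(j <- s | P j) F j).
Proof. by move=> FR; apply: big_ind => //; [exact: in_ring0 | exact: in_ringD]. Qed.
End InRing.

(** After division by the gcd, [y^N] is coprime to [x^N], hence divides [c], and
    its degree is too large unless [y] is a constant. *)
Lemma dvdp_exp_mul (F : fieldType) (c x y : {poly F}) (N : nat) :
  c != 0 -> y != 0 -> (size c <= N)%N -> y ^+ N %| c * x ^+ N -> y %| x.
Proof.
move=> c0 y0 ltcN dvd; set g := gcdp x y.
have g0 : g != 0 by rewrite gcdp_eq0 (negPf y0) andbF.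
have cop : coprimep (x %/ g) (y %/ g) by apply: coprimep_div_gcd; rewrite y0 orbT.
have Ex : x = x %/ g * g by rewrite divpK // dvdp_gcdl.
have Ey : y = y %/ g * g by rewrite divpK // dvdp_gcdr.
move: cop Ex Ey; set x' := x %/ g; set y' := y %/ g => cop Ex Ey.
move: dvd; rewrite Ex Ey !exprMn mulrA dvdp_mul2r ?expf_neq0 //.
rewrite Gauss_dvdpl; last by rewrite coprimep_expl ?coprimep_expr // coprimep_sym.
move=> /(dvdp_leq c0) le.
have y'0 : y' != 0 by apply: contraNneq y0 => y'0; rewrite Ey y'0 mul0r.
rewrite dvdp_mul2r //.
have s1 : size y' == 1.
  have s0 : (0 < size (y' ^+ N))%N by rewrite size_poly_gt0 expf_neq0.
  have sy : (0 < size y')%N by rewrite size_poly_gt0.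
  rewrite eqn_leq sy andbT -subn_eq0 subn1 -[_ == _]negbK -lt0n.
  apply/negP => s1; have := leq_trans le ltcN.
  by rewrite -(prednK s0) size_exp leqNgt ltnS leq_pmull.
by move: s1; rewrite size_poly_eq1 => /eqp_dvdl->; exact: dvd1p.
Qed.

(** By the case of a field, [z] is a polynomial over the field of fractions of
    [R]. Its leading coefficient is in [R] because [R] is [frob_closed], and it
    can be subtracted from [z]: raising to the power [N] is additive. *)
Lemma frob_closed_poly (q : nat) (R : idomainType) :
  q \in [pchar R] -> frob_closed q R -> frob_closed q {poly R}.
Proof.
move=> charR UR c c0.
have lc0 : lead_coef c != 0 by rewrite lead_coef_eq0.
have q1 : (1 < q)%N by rewrite prime_gt1 // (pcharf_prime charR).
have [i0 Ui0] := UR _ lc0.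
exists (maxn i0 (size c)) => i; rewrite geq_max => /andP[le0 lec] z.
set N := (q ^ i)%N.
have N0 : (0 < N)%N by rewrite expn_gt0 ltnW.
have ltcN : (size c <= N)%N by apply: leq_trans (ltnW (ltn_expl _ q1)).
have [x [y [y0 ->]]] := fracP z => -[w].
rewrite expr_div_n mulrA => /(congr1 ( *%R^~ (tofrac y ^+ N))).
rewrite divfK ?expf_neq0 ?tofrac_eq0 // -!rmorphXn -!rmorphM => /eqP.
rewrite tofrac_eq => /eqP E.
pose phi := map_poly (@tofrac R).
have phi_inj : injective phi.
  by apply: map_inj_poly; [exact: tofrac_inj | exact: rmorph0].
have phi0 p : p != 0 -> phi p != 0.
  by apply: contra_neq => p0; apply: phi_inj; rewrite p0 /phi rmorph0.
have charF : q \in [pchar {poly {fraction R}}].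
  by apply: (rmorph_pchar polyC); apply: (rmorph_pchar (@tofrac R)).
have main : forall n (Z : {poly {fraction R}}) w', (size Z <= n)%N ->
    phi c * Z ^+ N = phi w' -> exists v, Z = phi v.
  elim=> [|n IHn] Z w'.
    by rewrite leqn0 size_poly_eq0 => /eqP-> _; exists 0; rewrite /phi rmorph0.
  move=> leZ EZ; have [->|Z0] := eqVneq Z 0; first by exists 0; rewrite /phi rmorph0.
  have [a Ea] : in_ring (lead_coef Z).
    apply: (Ui0 i) => //; exists (lead_coef w').
    rewrite -/N -lead_coef_exp.
    rewrite -!(lead_coef_map_inj (@tofrac_inj R)) ?rmorph0 //.
    by rewrite -lead_coefM -[map_poly _ c]/(phi c) EZ.
  pose k := (size Z).-1; pose Z' := Z - phi (a%:P * 'X^k).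
  have EaX : phi (a%:P * 'X^k) = (lead_coef Z)%:P * 'X^k.
    by rewrite /phi rmorphM /= map_polyXn map_polyC /= -Ea.
  have [||v Ev] := IHn Z' (w' - c * (a%:P * 'X^k) ^+ N).
  - apply/leq_sizeP => j lej; rewrite /Z' EaX coefB mul_polyC coefZ coefXn.
    have [->|nejk] := eqVneq j k; first by rewrite mulr1 lead_coefE subrr.
    rewrite mulr0 subr0; apply/(leq_sizeP _ k.+1); first by rewrite -polySpred.
    rewrite ltn_neqAle eq_sym nejk /= /k; apply: leq_trans lej.
    by rewrite -ltnS prednK ?size_poly_gt0.
  - rewrite /Z' frobB // mulrBr EZ /phi rmorphB; congr (_ - _).
    by rewrite [RHS]rmorphM rmorphXn.
  by exists (v + a%:P * 'X^k); rewrite /phi rmorphD /= -[map_poly _ v]Ev subrK.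
have dvd : phi y %| phi x.
  apply: (@dvdp_exp_mul _ (phi c) _ _ N); rewrite ?phi0 //.
    by rewrite /phi size_map_poly_id0 // tofrac_eq0.
  apply/dvdpP; exists (phi w).
  by rewrite /phi -!rmorphXn -!rmorphM /= E.
have EZ : phi x = phi x %/ phi y * phi y by rewrite divpK.
have [|v Ev] := main _ (phi x %/ phi y) w (leqnn _).
  apply: (@mulIf _ (phi y ^+ N)); first by rewrite expf_neq0 // phi0.
  rewrite -mulrA -exprMn -EZ /phi -!rmorphXn -!rmorphM /=.
  by rewrite E.
exists v; apply: (@mulIf _ (tofrac y)); first by rewrite tofrac_eq0.
rewrite divfK ?tofrac_eq0 // -rmorphM; congr tofrac; apply: phi_inj.
by rewrite EZ Ev /phi rmorphM.
Qed.

Lemma mpoly_ring_ind (n : nat) (R : nzRingType) (P : {mpoly R[n]} -> Prop) :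
  (forall c, P c%:MP) -> (forall i, P 'X_i) ->
  (forall p r, P p -> P r -> P (p + r)) ->
  (forall p r, P p -> P r -> P (p * r)) -> forall p, P p.
Proof.
move=> PC PX PD PM p; rewrite [p]mpolyE.
apply: big_ind => [|//|m _]; first by rewrite -mpolyC0.
rewrite -mul_mpolyC; apply: (PM) => //; rewrite mpolyXE_id.
apply: big_ind => [|//|i _]; first by rewrite -mpolyC1.
by elim: (m i) => [|e IHe]; rewrite ?expr0 -?mpolyC1 // exprS; apply: PM.
Qed.

Section MpolySucc.
Variables (n : nat) (R : comNzRingType).

Lemma muni_widen (p : {mpoly R[n]}) : muni (mwiden p) = p%:P.
Proof.
elim/mpoly_ring_ind: p => [c|i|p r Ep Er|p r Ep Er].
- by rewrite mwidenC muniC.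
- rewrite mwidenX mnmwiden1 muniE msuppX big_seq1 mcoeffX eqxx scale1r.
  have -> : U_(widen_ord (leqnSn n) i)%MM ord_max = 0%N.
    by rewrite mnm1E -val_eqE /= ltn_eqF.
  rewrite expr0 alg_polyC; congr ('X_[ _ ])%:P; apply/mnmP => j.
  by rewrite mnmE !mnm1E -!val_eqE.
- by rewrite mwidenD muniD Ep Er -polyCD.
- by rewrite mwidenM muniM Ep Er -polyCM.
Qed.

Lemma muni_max : muni ('X_ord_max : {mpoly R[n.+1]}) = 'X.
Proof.
rewrite muniE msuppX big_seq1 mcoeffX eqxx scale1r mnm1E eqxx expr1.
rewrite (_ : [multinom _ | _ < _] = 0%MM) ?mpolyX0 ?scale1r //.
by apply/mnmP => j; rewrite mnmE mnm1E mnm0E -val_eqE /= gtn_eqF.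
Qed.

Lemma muni_surj (P : {poly {mpoly R[n]}}) :
  exists p : {mpoly R[n.+1]}, muni p = P.
Proof.
elim/poly_ind: P => [|P c [p <-]]; first by exists 0; rewrite muni0.
by exists (p * 'X_ord_max + mwiden c); rewrite muniD muniM muni_max muni_widen.
Qed.

(** Together with [muni] this identifies [R[X_0, .., X_n]] with the univariate
    polynomials over [R[X_0, .., X_(n-1)]], which is what allows inductions on the
    number of variables. *)
Definition unmuni (P : {poly {mpoly R[n]}}) : {mpoly R[n.+1]} :=
  (map_poly (@mwiden n R) P).['X_ord_max].

Lemma unmuniD : {morph unmuni : P Q / P + Q}.
Proof. by move=> P Q; rewrite /unmuni rmorphD hornerD. Qed.

Lemma unmuniM : {morph unmuni : P Q / P * Q}.
Proof. by move=> P Q; rewrite /unmuni rmorphM hornerM. Qed.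

Lemma muniK : cancel (@muni n R) unmuni.
Proof.
move=> p; elim/mpoly_ring_ind: p => [c|i|p r Ep Er|p r Ep Er].
- by rewrite muniC /unmuni map_polyC hornerC /= mwidenC.
- have [j ->|->] := unliftP ord_max i.
    have -> : lift ord_max j = widen_ord (leqnSn n) j.
      by apply: val_inj; rewrite /= /bump leqNgt ltn_ord.
    have -> : 'X_(widen_ord (leqnSn n) j) = mwiden ('X_j : {mpoly R[n]}).
      by rewrite mwidenX mnmwiden1.
    by rewrite muni_widen /unmuni map_polyC hornerC.
  by rewrite muni_max /unmuni map_polyX hornerX.
- rewrite (muniD p r) (unmuniD (muni p) (muni r)).
  exact: (congr2 +%R Ep Er).
- rewrite (muniM p r) (unmuniM (muni p) (muni r)).
  exact: (congr2 *%R Ep Er).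
Qed.
End MpolySucc.

Lemma frob_closed_iso (q : nat) (R R' : idomainType) (g : {rmorphism R' -> R}) :
  injective g -> (forall a, exists b, g b = a) ->
  frob_closed q R -> frob_closed q R'.
Proof.
move=> g_inj g_surj UR c c0.
have g0 b : b != 0 -> g b != 0.
  by move=> b0; rewrite -(rmorph0 g) (inj_eq g_inj).
have [i0 Ui0] := UR _ (g0 _ c0); exists i0 => i lei z.
have [x [y [y0 ->]]] := fracP z => -[w Ew].
have [|v Ev] := Ui0 i lei (tofrac (g x) / tofrac (g y)).
  exists (g w); move: Ew; rewrite !expr_div_n => Ew.
  apply: (@mulIf _ (tofrac (g y) ^+ (q ^ i))); rewrite ?expf_neq0 ?tofrac_eq0 ?g0 //.
  rewrite mulrA divfK ?expf_neq0 ?tofrac_eq0 ?g0 // -!rmorphXn -!rmorphM.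
  apply: (congr1 (fun a => tofrac (g a))); apply/eqP; rewrite -tofrac_eq.
  rewrite !tofracM !tofracXn -Ew mulrA divfK //.
  by rewrite expf_neq0 ?tofrac_eq0.
have [v' Ev'] := g_surj v; exists v'.
apply: (@mulIf _ (tofrac y)); first by rewrite tofrac_eq0.
rewrite divfK ?tofrac_eq0 // -rmorphM; congr tofrac; apply: g_inj.
move/(congr1 ( *%R^~ (tofrac (g y)))): Ev; rewrite divfK ?tofrac_eq0 ?g0 //.
by rewrite -tofracM rmorphM Ev' => /eqP; rewrite tofrac_eq => /eqP.
Qed.

Lemma frob_closed_field (q : nat) (k : fieldType) : frob_closed q k.
Proof.
move=> c _; exists 0%N => i _ z _; have [x [y [y0 ->]]] := fracP z.
by exists (x / y); rewrite fmorph_div.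
Qed.

Lemma frob_closed_mpoly (q : nat) (k : fieldType) (n : nat) :
  q \in [pchar k] -> frob_closed q {mpoly k[n]}.
Proof.
move=> chark; elim: n => [|n IHn].
  apply: (@frob_closed_iso _ k _ (@mcoeff 0 k 0%MM)).
  - exact: (can_inj (@mpolyKC k)).
  - by move=> a; exists a%:MP => /=; rewrite mcoeffC eqxx mulr1.
  - exact: frob_closed_field.
apply: (@frob_closed_iso _ {poly {mpoly k[n]}} _ (@muni n k)).
- exact: can_inj (@muniK n k).
- exact: muni_surj.
- by apply: frob_closed_poly IHn; apply: (rmorph_pchar (@mpolyC n k)).
Qed.

(** * Noetherian rings *)

(** [K] is seen as a module over [R] through [f]. With [f] the identity this
    gives ideals, with [R] a field it gives subspaces. *)
Fixpoint lspan (R K : pzRingType) (f : R -> K) (s : seq K) (x : K) : Prop :=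
  if s is y :: s' then exists a z, lspan f s' z /\ x = f a * y + z else x = 0.

Section Span.
Variables (R K : pzRingType) (f : {rmorphism R -> K}).
Implicit Types (s t : seq K) (x y : K).

Lemma lspan0 s : lspan f s 0.
Proof.
by elim: s => //= y s IHs; exists 0, 0; rewrite rmorph0 mul0r addr0.
Qed.

Lemma lspanD s x y : lspan f s x -> lspan f s y -> lspan f s (x + y).
Proof.
elim: s x y => [|z s IHs] x y /=; first by move=> -> ->; rewrite addr0.
move=> [a [u [su ->]]] [b [v [sv ->]]]; exists (a + b), (u + v).
by split; [exact: IHs | rewrite rmorphD mulrDl addrACA].
Qed.

Lemma lspanM s a x : lspan f s x -> lspan f s (f a * x).
Proof.
elim: s x => [|z s IHs] x /=; first by move=> ->; rewrite mulr0.
move=> [b [u [su ->]]]; exists (a * b), (f a * u).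
by split; [exact: IHs | rewrite rmorphM mulrDr mulrA].
Qed.

Lemma lspan_mem s x : x \in s -> lspan f s x.
Proof.
elim: s => //= z s IHs; rewrite inE => /predU1P[->|/IHs sx].
  by exists 1, 0; rewrite rmorph1 mul1r addr0; split=> //; exact: lspan0.
by exists 0, x; rewrite rmorph0 mul0r add0r.
Qed.

Lemma lspan_min (J : K -> Prop) s x :
  J 0 -> (forall y z, J y -> J z -> J (y + z)) -> (forall a y, J y -> J (f a * y)) ->
  (forall y, y \in s -> J y) -> lspan f s x -> J x.
Proof.
move=> J0 JD JM; elim: s x => [|y s IHs] x Js /=; first by move->.
move=> [a [z [sz ->]]]; apply: (JD).
  by apply: (JM); apply: Js; rewrite mem_head.
by apply: IHs sz => u su; apply: Js; rewrite inE su orbT.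
Qed.

Lemma lspan_sub s t x :
  (forall y, y \in s -> lspan f t y) -> lspan f s x -> lspan f t x.
Proof.
apply: lspan_min => [|y z|a y]; first exact: lspan0.
  exact: lspanD.
exact: lspanM.
Qed.

Lemma lspan_subset s t x : {subset s <= t} -> lspan f s x -> lspan f t x.
Proof. by move=> st; apply: lspan_sub => y /st; exact: lspan_mem. Qed.

Lemma lspan_ord s x : lspan f s x ->
  exists c : 'I_(size s) -> R, x = \sum_(i < size s) f (c i) * s`_i.
Proof.
suff main : lspan f s x -> exists c : nat -> R, x = \sum_(i < size s) f (c i) * s`_i.
  by move=> /main[c ->]; exists (fun i => c i).
elim: s x => [|y s IHs] x /=; first by move=> ->; exists (fun=> 0); rewrite big_ord0.
move=> [a [z [/IHs[c ->] ->]]]; exists (fun i => if i is j.+1 then c j else a).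
by rewrite big_ord_recl.
Qed.
End Span.

Notation ideal_span := (lspan idfun).

(** The generators are taken in the given set: for a family of powers, they are
    powers themselves. *)
Definition noetherian (R : pzRingType) := forall X : R -> Prop,
  exists s : seq R, (forall y, y \in s -> X y) /\ forall x, X x -> ideal_span s x.

(** A relation between leading coefficients lifts to a relation between the
    polynomials, after multiplication by powers of the variable that bring them
    all to the same degree. *)
Lemma lead_coef_span (R : nzRingType) (m : nat) (a : R) (t : seq {poly R}) :
  (forall p, p \in t -> size p <= m.+1)%N ->
  ideal_span (map lead_coef t) a ->
  exists g, [/\ ideal_span t g, (size g <= m.+1)%N & g`_m = a].
Proof.
elim: t a => [|p t IHt] a let_ /=.
  by move=> ->; exists 0; rewrite size_poly0 coef0.
move=> [b [z [tz ->]]].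
have [|g [tg leg <-]] := IHt z _ tz.
  by move=> r tr; apply: let_; rewrite inE tr orbT.
have lep : (size p <= m.+1)%N by apply: let_; rewrite mem_head.
exists (b%:P * 'X^(m.+1 - size p) * p + g); split.
- by exists (b%:P * 'X^(m.+1 - size p)), g.
- rewrite (leq_trans (size_polyD _ _)) // geq_max leg andbT -mulrA mul_polyC.
  rewrite (leq_trans (size_scale_leq _ _)) // -commr_polyXn.
  have [->|p0] := eqVneq p 0; first by rewrite mul0r size_poly0.
  by rewrite size_Mmonic ?monicXn // size_polyXn addnS /= subnKC.
rewrite coefD -mulrA coefCM -commr_polyXn coefMXn.
have [->|p0] := eqVneq p 0; first by rewrite lead_coef0 coef0 if_same.
have lt0 : (0 < size p)%N by rewrite size_poly_gt0.
rewrite ltnNge leq_subLR -{1}(prednK lt0) addSn ltnS leq_addl /= lead_coefE.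
by congr (_ * _ + _); congr (p`_ _); rewrite -[in LHS](prednK lt0) subSS subKn // -ltnS prednK.
Qed.

(** If the ideal [J] generated by [X] were not finitely generated, choose
    repeatedly an element of minimal degree of [J] outside the span of the
    previous ones. The leading coefficient of some such element is a combination
    of the previous leading coefficients; subtracting the corresponding
    combination of polynomials contradicts minimality. *)
Theorem hilbert_basis (R : nzRingType) : noetherian R -> noetherian {poly R}.
Proof.
move=> nR X; apply: contrapT => notX.
pose J p := exists s, (forall y, y \in s -> X y) /\ ideal_span s p.
have JD p r : J p -> J r -> J (p + r).
  move=> [s [sX sp]] [t [tX tr]]; exists (s ++ t); split.
    by move=> y; rewrite mem_cat => /orP[/sX|/tX].
  by apply: lspanD; [apply: lspan_subset sp | apply: lspan_subset tr];
    move=> y y_in; rewrite mem_cat y_in ?orbT.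
have JM a p : J p -> J (a * p).
  by move=> [s [sX sp]]; exists s; split=> //; apply: (@lspanM _ _ idfun).
have J0 : J 0 by exists [::].
have Jspan t p : (forall y, y \in t -> J y) -> ideal_span t p -> J p.
  exact: lspan_min.
have notJ t : (forall y, y \in t -> J y) -> exists p, J p /\ ~ ideal_span t p.
  move=> tJ; apply: contrapT => noP; apply: notX.
  have [s [sX st]] : exists s, (forall y, y \in s -> X y) /\
      forall y, y \in t -> ideal_span s y.
    elim: t tJ {noP} => [|y t IHt] tJ; first by exists [::].
    have [|s [sX st]] := IHt; first by move=> z tz; apply: tJ; rewrite inE tz orbT.
    have [|s' [s'X s'y]] := tJ y; first by rewrite mem_head.
    exists (s' ++ s); split.
      by move=> z; rewrite mem_cat => /orP[/s'X|/sX].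
    move=> z; rewrite inE => /predU1P[->|/st sz].
      by apply: lspan_subset s'y => u u_in; rewrite mem_cat u_in.
    by apply: lspan_subset sz => u u_in; rewrite mem_cat u_in orbT.
  exists s; split=> // x Xx; apply: (lspan_sub st).
  apply: contrapT => tx; apply: noP; exists x; split=> //.
  exists [:: x]; split; last by apply: lspan_mem; rewrite mem_head.
  by move=> y; rewrite inE => /eqP->.
have /choice[next nextP] : forall t, exists r, (forall y, y \in t -> J y) -> [/\ J r,
    ~ ideal_span t r & forall p, J p -> ~ ideal_span t p -> (size r <= size p)%N].
  move=> t; have [tJ|] := pselect (forall y, y \in t -> J y); last by exists 0.
  have : exists n, `[< exists p, [/\ J p, ~ ideal_span t p & size p = n] >].
    by have [p [Jp tp]] := notJ t tJ; exists (size p); apply/asboolP; exists p.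
  case/ex_minnP => n /asboolP[r [Jr tr <-]] minr; exists r => _; split=> // p Jp tp.
  by apply: minr; apply/asboolP; exists p.
pose T n := iter n (fun t => next t :: t) [::].
have TJ n y : y \in T n -> J y.
  elim: n y => [|n IHn] y //=; rewrite inE => /predU1P[->|/IHn //].
  by have [] := nextP (T n) IHn.
have Tmono k n : (k <= n)%N -> {subset T k <= T n}.
  elim: n => [|n IHn]; first by rewrite leqn0 => /eqP->.
  rewrite leq_eqVlt => /predU1P[-> //|/IHn sub] y /sub Ty.
  by rewrite /= inE Ty orbT.
have Tin n y : y \in T n -> exists2 k, (k < n)%N & y = next (T k).
  elim: n => //= n IHn; rewrite inE => /predU1P[->|/IHn[k ltk ->]].
    by exists n.
  by exists k => //; apply: ltnW.
have [s [sY sspan]] := nR (fun a => exists n, a = lead_coef (next (T n))).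
have [N sN] : exists N, forall a, a \in s -> a \in map lead_coef (T N).
  elim: s sY {sspan} => [|a s IHs] sY; first by exists 0%N.
  have [|N sN] := IHs; first by move=> b sb; apply: sY; rewrite inE sb orbT.
  have [|n ->] := sY a; first by rewrite mem_head.
  exists (maxn N n.+1) => b; rewrite inE => /predU1P[->|/sN].
    by apply: map_f; apply: (Tmono n.+1); rewrite ?leq_maxr //= mem_head.
  by move=> /mapP[p Tp ->]; apply: map_f; apply: (Tmono N); rewrite ?leq_maxl.
have [JN notN minN] := nextP (T N) (TJ N).
have N0 : next (T N) != 0.
  by apply: contra_notN notN => /eqP->; exact: lspan0.
have szN : (0 < size (next (T N)))%N by rewrite size_poly_gt0.
have [||g [Tg leg Eg]] :=
    @lead_coef_span R (size (next (T N))).-1 (lead_coef (next (T N))) (T N).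
- move=> p /Tin[k ltk ->]; rewrite prednK //.
  have [_ _ mink] := nextP (T k) (TJ k); apply: mink => // Tk.
  by apply: notN; apply: lspan_subset Tk; apply: Tmono; apply: ltnW.
- by apply: (lspan_subset sN); apply: sspan; exists N.
have JB : J (next (T N) - g).
  by apply: JD => //; rewrite -mulN1r; apply: JM; apply: Jspan Tg; apply: TJ.
have notB : ~ ideal_span (T N) (next (T N) - g).
  by move=> TB; apply: notN; rewrite -[next _](subrK g); apply: lspanD.
have := minN _ JB notB; rewrite leqNgt => /negP; apply.
rewrite -[X in (_ < X)%N](prednK szN) ltnS; apply/leq_sizeP => j.
rewrite leq_eqVlt => /predU1P[<-|ltj]; first by rewrite coefB Eg lead_coefE subrr.
have lej : (size (next (T N)) <= j)%N by rewrite -(prednK szN).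
by rewrite coefB !nth_default ?subrr // (leq_trans leg).
Qed.

Lemma noetherian_image (R S : pzRingType) (h : R -> S) :
  {morph h : x y / x + y} -> {morph h : x y / x * y} -> h 0 = 0 ->
  (forall y, exists x, h x = y) -> noetherian R -> noetherian S.
Proof.
move=> hD hM h0 h_surj nR X; have [s [sX lspanX]] := nR (X \o h).
exists (map h s); split; first by move=> _ /mapP[x /sX ? ->].
move=> y; have [x <-] := h_surj y => /lspanX.
elim: s x {sX lspanX} => [|z s IHs] x /=; first by move=> ->.
by move=> [a [u [/IHs su ->]]]; exists (h a), (h u); rewrite hD hM.
Qed.

Lemma noetherian_field (k : fieldType) : noetherian k.
Proof.
move=> X; have [[x [Xx x0]]|noX] := pselect (exists x, X x /\ x != 0).
  exists [:: x]; split; first by move=> y; rewrite inE => /eqP->.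
  by move=> y _; exists (y / x), 0; rewrite addr0 divfK.
exists [::]; split=> // x Xx /=; apply/eqP; apply: contrapT => /negP x0.
by apply: noX; exists x.
Qed.

Lemma noetherian_mpoly (R : comNzRingType) (n : nat) :
  noetherian R -> noetherian {mpoly R[n]}.
Proof.
move=> nR; elim: n => [|n IHn].
  apply: (noetherian_image (@mpolyCD 0 R) (@mpolyCM 0 R) (mpolyC0 _ _)) nR => p.
  by exists (p@_0%MM); apply: mpolyKC.
apply: (noetherian_image (@unmuniD n R) (@unmuniM n R)) (hilbert_basis IHn).
  by rewrite /unmuni map_poly0 horner0.
by move=> p; exists (muni p); exact: muniK.
Qed.

(** * Integral elements and finite dimensional extensions *)
Record subring (K : pzRingType) (S : K -> Prop) : Prop := Subring {
  subring1 : S 1;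
  subringB : forall x y, S x -> S y -> S (x - y);
  subringM : forall x y, S x -> S y -> S (x * y)
}.

Section Subring.
Variables (K : comPzRingType) (S : K -> Prop) (S_ring : subring S).

Lemma subring0 : S 0.
Proof. by rewrite -(subrr 1); apply: subringB => //; apply: subring1. Qed.

Lemma subringN x : S x -> S (- x).
Proof. by rewrite -sub0r; apply: subringB => //; exact: subring0. Qed.

Lemma subringD x y : S x -> S y -> S (x + y).
Proof. by move=> Sx Sy; rewrite -[y]opprK; apply: subringB => //; exact: subringN. Qed.

Lemma subringX x n : S x -> S (x ^+ n).
Proof.
move=> Sx; elim: n => [|n IHn]; first by rewrite expr0; exact: subring1.
by rewrite exprS; apply: subringM.
Qed.

Lemma subring_sum (J : Type) (s : seq J) (P : pred J) (F : J -> K) :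
  (forall j, P j -> S (F j)) -> S (\sum_(j <- s | P j) F j).
Proof. by move=> SF; apply: big_ind => //; [exact: subring0 | exact: subringD]. Qed.

Lemma subring_prod (J : Type) (s : seq J) (P : pred J) (F : J -> K) :
  (forall j, P j -> S (F j)) -> S (\prod_(j <- s | P j) F j).
Proof.
move=> SF; apply: big_ind => //; first exact: subring1.
by move=> x y; apply: subringM.
Qed.
End Subring.

Lemma subring_mpoly (n : nat) (R : comNzRingType) (K : comNzRingType)
    (g : {rmorphism {mpoly R[n]} -> K}) (S : K -> Prop) :
  subring S -> (forall c, S (g c%:MP)) -> (forall i, S (g 'X_i)) -> forall p, S (g p).
Proof.
move=> S_ring SC SX; elim/mpoly_ring_ind => // p r Sp Sr.
  by rewrite rmorphD; apply: subringD.
by rewrite rmorphM; apply: subringM.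
Qed.

(** The subring generated by [C], as the intersection of the subrings that
    contain it: inclusions of subrings are then checked on generators. *)
Definition gen_ring (K : pzRingType) (C : K -> Prop) (x : K) :=
  forall S, subring S -> (forall y, C y -> S y) -> S x.

Lemma gen_ring_subring (K : pzRingType) (C : K -> Prop) : subring (gen_ring C).
Proof.
split=> [S SS _|x y Gx Gy S SS CS|x y Gx Gy S SS CS]; first exact: subring1.
  by apply: subringB => //; [apply: Gx | apply: Gy].
by apply: subringM => //; [apply: Gx | apply: Gy].
Qed.

Lemma gen_ring_mem (K : pzRingType) (C : K -> Prop) x : C x -> gen_ring C x.
Proof. by move=> Cx S _; apply. Qed.

Lemma subring_integral (R K : comNzRingType) (f : {rmorphism R -> K}) :
  subring (integralOver f).
Proof.
split=> [|x y|x y]; [exact: integral1 | exact: integral_sub | exact: integral_mul].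
Qed.

(** The powers of an integral element stay in a finitely generated module; this is
    how common denominators of all the powers are found. *)
Lemma integral_powers (R K : comNzRingType) (f : {rmorphism R -> K}) (b : K) :
  integralOver f b -> exists n, forall k,
  lspan f [seq b ^+ j | j <- iota 0 n] (b ^+ k).
Proof.
case=> p p_mon /rootP p_b; pose n := (size p).-1; exists n => k.
have szp : size p = n.+1 by rewrite prednK // size_poly_gt0 monic_neq0.
elim/ltn_ind: k => k IHk.
have [ltkn|lenk] := ltnP k n.
  by apply: lspan_mem; apply: map_f; rewrite mem_iota.
rewrite -(subnK lenk) exprD.
have -> : b ^+ n = - \sum_(j < n) f p`_j * b ^+ j.
  apply/eqP; rewrite -addr_eq0 addrC -[X in _ == X]p_b.
  rewrite (@horner_coef_wide _ n.+1); last first.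
    by rewrite -szp (size_poly _).
  have lc1 : (map_poly f p)`_n = 1.
    by rewrite coef_map -/n -lead_coefE (monicP p_mon); exact: rmorph1.
  rewrite big_ord_recr /= lc1 mul1r; apply/eqP; congr (_ + _).
  by apply: eq_bigr => j _; rewrite coef_map.
rewrite mulrN -mulNr mulr_sumr; apply: big_ind => [|x y|j _].
- exact: lspan0.
- exact: lspanD.
rewrite mulrCA mulNr mulrN -mulNr -rmorphN -exprD.
by apply/lspanM/IHk; rewrite -[X in (_ < X)%N](subnK lenk) ltn_add2l.
Qed.

Lemma common_multiple (R : idomainType) (n : nat) (Q : nat -> R -> Prop) :
  (forall k d e, Q k d -> Q k (d * e)) ->
  (forall k, (k < n)%N -> exists2 d, d != 0 & Q k d) ->
  exists2 d, d != 0 & forall k, (k < n)%N -> Q k d.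
Proof.
move=> QM; elim: n => [|n IHn] Qn; first by exists 1; rewrite ?oner_neq0.
have [|d d0 dQ] := IHn; first by move=> k ltk; apply/Qn/ltnW.
have [e e0 eQ] := Qn n (leqnn _); exists (d * e); first exact: mulf_neq0.
move=> k; rewrite ltnS leq_eqVlt => /predU1P[->|ltk]; last exact/QM/dQ.
by rewrite mulrC; apply: QM.
Qed.

Lemma common_denom (R : idomainType) (I : finType) (z : I -> {fraction R}) :
  exists2 d : R, d != 0 & forall i, in_ring (tofrac d * z i).
Proof.
have [||d d0 dQ] := @common_multiple R #|I|
    (fun k d => forall i, enum_rank i = k :> nat -> in_ring (tofrac d * z i)).
- move=> k d e dQ i Ei; rewrite tofracM mulrAC.
  by apply: in_ringM; [exact: dQ | exact: in_ring_tofrac].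
- move=> k ltk; have [a [b [b0 Ez]]] := fracP (z (enum_val (Ordinal ltk))).
  exists b => // i Ei; rewrite -[i]enum_rankK.
  have -> : enum_rank i = Ordinal ltk by apply: val_inj.
  by rewrite Ez mulrC divfK ?tofrac_eq0 //; apply: in_ring_tofrac.
by exists d => // i; apply: (dQ (enum_rank i)).
Qed.

Section FiniteDim.
Variables (F L : fieldType) (f : {rmorphism F -> L}).

(** Divide a monic equation of [v^-1] by a power of [v^-1]: it expresses [v^-1] as
    a polynomial in [v]. *)
Lemma inv_in_subring (S : L -> Prop) (v : L) :
  subring S -> (forall c, S (f c)) -> S v -> integralOver f v -> S v^-1.
Proof.
move=> S_ring Sf Sv v_int; have [->|v0] := eqVneq v 0.
  by rewrite invr0; apply: subring0.
have [p p_mon /rootP p_v] : integralOver f v^-1 by apply: integral_inv.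
pose n := (size p).-1.
have szp : size p = n.+1 by rewrite prednK // size_poly_gt0 monic_neq0.
case: n szp => [|n] szp.
  by move: p_v; rewrite (size1_polyC (eq_leq szp)) map_polyC hornerC /=;
    have := p_mon; rewrite monicE lead_coefE szp /= => /eqP->; rewrite rmorph1 => /eqP;
    rewrite oner_eq0.
have lc1 : (map_poly f p)`_n.+1 = 1.
  by rewrite coef_map -[n.+1]/(n.+2.-1) -szp -lead_coefE (monicP p_mon); exact: rmorph1.
move/(congr1 ( *%R (v ^+ n))): p_v; rewrite mulr0.
rewrite (@horner_coef_wide _ n.+2); last by rewrite -szp (size_poly _).
rewrite big_ord_recr /= lc1 mul1r mulrDr exprVn exprS invfM mulrCA mulfV ?expf_neq0 //.
rewrite mulr1 => /eqP; rewrite addrC addr_eq0 => /eqP->.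
apply: subringN => //; rewrite mulr_sumr; apply: subring_sum => // j _.
rewrite coef_map mulrCA; apply: subringM => //; first exact: Sf.
have lej : (j <= n)%N by rewrite -ltnS.
by rewrite exprVn -exprB ?unitfE //; apply: subringX.
Qed.

(** The elements that map a finitely generated space [T] to itself form a ring;
    with [1] in [T], this ring lies in [T]. A space stable under all elements of
    [s] is built by adjoining the powers of one element at a time. *)
Lemma finite_span (s : seq L) : (forall y, y \in s -> integralOver f y) ->
  exists t : seq L, forall x,
    gen_ring (fun y => (exists c, y = f c) \/ y \in s) x -> lspan f t x.
Proof.
move=> s_int.
suff [t [t1 tM]] : exists t : seq L, 1 \in t /\
    forall y z, y \in s -> lspan f t z -> lspan f t (y * z).
  exists t => x Gx; rewrite -[x]mulr1.
  apply: (Gx (fun y => forall z, lspan f t z -> lspan f t (y * z)) _ _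
    1 (lspan_mem f t1)) => [|y].
    split=> [z|y z Ty Tz w tw|y z Ty Tz w tw]; rewrite ?mul1r //.
      rewrite mulrBl; apply: lspanD; first exact: Ty.
      by rewrite -mulN1r -(rmorphN1 f); apply/lspanM/Tz.
    by rewrite -mulrA; apply/Ty/Tz.
  by case=> [[c ->] z|sy z tz]; [exact: lspanM | exact: tM].
elim: s s_int => [|a s IHs] s_int; first by exists [:: 1]; rewrite mem_head.
have [|t [t1 tM]] := IHs; first by move=> y sy; apply: s_int; rewrite inE sy orbT.
have [|n an] := integral_powers (b := a) (f := f) _.
  by apply: s_int; rewrite mem_head.
pose t' := [seq y * x | y <- t, x <- [seq a ^+ j | j <- iota 0 n]].
have tt' y k : lspan f t y -> lspan f t' (y * a ^+ k).
  move=> ty; pose J z := lspan f t' (z * a ^+ k).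
  apply: (@lspan_min _ _ f J t) ty => [|u v Ju Jv|c u Ju|u tu]; rewrite /J.
  - by rewrite mul0r; apply: lspan0.
  - by rewrite mulrDl; apply: lspanD.
  - by rewrite -mulrA; apply: lspanM.
  rewrite mulrC; pose J' z := lspan f t' (z * u).
  apply: (@lspan_min _ _ f J' _ _ _ _ _ _ (an k)) => [|w v Ju Jv|c w Ju|w aw]; rewrite /J'.
  - by rewrite mul0r; apply: lspan0.
  - by rewrite mulrDl; apply: lspanD.
  - by rewrite -mulrA; apply: lspanM.
  by rewrite mulrC; apply: lspan_mem; apply: allpairs_f.
exists (1 :: t'); split; first by rewrite mem_head.
have sub z : lspan f (1 :: t') z -> lspan f t' z.
  apply: lspan_sub => y; rewrite inE => /predU1P[->|]; last exact: lspan_mem.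
  by rewrite -[1]mulr1 -(expr0 a); apply: tt'; apply: lspan_mem.
move=> y z sy /sub t'z; apply: (lspan_subset (s := t')).
  by move=> u tu; rewrite inE tu orbT.
pose J z := lspan f t' (y * z).
apply: (@lspan_min _ _ f J t') t'z => [|u v Ju Jv|c u Ju|u]; rewrite /J.
- by rewrite mulr0; apply: lspan0.
- by rewrite mulrDr; apply: lspanD.
- by rewrite mulrCA; apply: lspanM.
move=> /allpairsP[[u1 u2] [/= tu1 /mapP[j _ ->] ->]].
move: sy; rewrite inE => /predU1P[->|sy].
  by rewrite mulrCA -exprS; apply/tt'/lspan_mem.
by rewrite mulrA; apply: tt'; apply: tM => //; exact: lspan_mem.
Qed.

Definition combination m (h : 'I_m -> L) (x : L) :=
  exists c : 'I_m -> F, x = \sum_i f (c i) * h i.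

Definition independent m (h : 'I_m -> L) :=
  forall c : 'I_m -> F, \sum_i f (c i) * h i = 0 -> forall i, c i = 0.

(** A dependency in which [h j] occurs allows [h j] to be eliminated. *)
Lemma combination_drop m (h : 'I_m.+1 -> L) (c : 'I_m.+1 -> F) j x :
  \sum_i f (c i) * h i = 0 -> c j != 0 ->
  combination h x -> combination (fun i => h (lift j i)) x.
Proof.
move=> ch cj [d ->]; exists (fun i => d (lift j i) - d j / c j * c (lift j i)).
rewrite -[LHS]subr0 -[X in _ - X](mulr0 (f (d j / c j))) -[X in _ * X]ch.
rewrite mulr_sumr -sumrB (bigD1_ord j) //= [X in X + _](_ : _ = 0) ?add0r.
  by apply: eq_bigr => i _; rewrite rmorphB mulrBl (rmorphM f (d j / c j)) mulrA.
by rewrite mulrA -rmorphM divfK ?subrr.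
Qed.

Lemma exists_basis m (h : 'I_m -> L) : (forall x, combination h x) ->
  exists (m' : nat) (h' : 'I_m' -> L), (forall x, combination h' x) /\ independent h'.
Proof.
move=> h_span; pose P n := `[< exists h' : 'I_n -> L, forall x, combination h' x >].
have : exists n, P n by exists m; apply/asboolP; exists h.
case/ex_minnP => n /asboolP[h' h'_span] minn; exists n, h'; split=> //.
move=> c ch i; apply: contrapT => /eqP ci.
case: n h' h'_span minn c ch i ci => [|n] h' h'_span minn c ch i ci; first by case: i ci.
have : P n.
  apply/asboolP; exists (fun k => h' (lift i k)) => x.
  exact: combination_drop ch ci (h'_span x).
by move=> /minn; rewrite ltnn.
Qed.

Lemma free_inj m (h : 'I_m -> L) (c d : 'I_m -> F) : independent h ->
  \sum_i f (c i) * h i = \sum_i f (d i) * h i -> c =1 d.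
Proof.
move=> h_free E i; apply/eqP; rewrite -subr_eq0; apply/eqP.
apply: (h_free (fun i => c i - d i)).
under eq_bigr do rewrite rmorphB mulrBl.
by rewrite sumrB E subrr.
Qed.

(** [rho x] is the matrix of the multiplication by [x] in a basis; as [L] is
    commutative, acting on rows of coordinates still gives a morphism. *)
Lemma regular_representation m (h : 'I_m -> L) : (forall x, combination h x) ->
  exists (m' : nat) (rho : {rmorphism L -> 'M[F]_m'.+1}), forall c, rho (f c) = c%:M.
Proof.
move=> /exists_basis{m h}[m [h [/choice[co coE] h_free]]].
have co_uniq x (c : 'I_m -> F) : x = \sum_i f (c i) * h i -> co x =1 c.
  by move=> Ex; apply: (free_inj h_free); rewrite -coE.
case: m h co coE h_free co_uniq => [|m] h co coE h_free co_uniq.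
  by have /eqP := coE 1; rewrite big_ord0 oner_eq0.
pose r x : 'M[F]_m.+1 := \matrix_(i, j) co (x * h i) j.
have rB : zmod_morphism r.
  move=> x y; apply/matrixP => i j; rewrite !mxE.
  apply: (co_uniq _ (fun j => co (x * h i) j - co (y * h i) j)).
  under eq_bigr do rewrite rmorphB mulrBl.
  by rewrite sumrB -!coE mulrBl.
have rC c : r (f c) = c%:M.
  apply/matrixP => i j; rewrite !mxE.
  apply: (co_uniq _ (fun j => c *+ (i == j))).
  rewrite (bigD1 i) //= eqxx mulr1n big1 ?addr0 // => k.
  by rewrite eq_sym => /negPf->; rewrite mulr0n rmorph0 mul0r.
have rM : monoid_morphism r.
  split; first by rewrite -(rmorph1 f) rC.
  move=> x y; apply/matrixP => i k; rewrite !mxE.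
  apply: (co_uniq _ (fun k => \sum_j r x i j * r y j k)).
  under eq_bigr do rewrite rmorph_sum mulr_suml /=.
  rewrite exchange_big /= mulrAC [x * _]coE mulr_suml; apply: eq_bigr => j _.
  rewrite -mulrA [h j * y]mulrC [y * h j]coE mulr_sumr; apply: eq_bigr => l _.
  by rewrite !mxE rmorphM mulrA.
pose rA := GRing.isZmodMorphism.Build _ _ r rB.
pose rR := GRing.isMonoidMorphism.Build _ _ r rM.
pose rho : {rmorphism L -> 'M[F]_m.+1} := HB.pack r rA rR.
by exists m, rho.
Qed.
End FiniteDim.

(** * Characteristic polynomials and Frobenius *)
Lemma frobB_comm (q : nat) (R : nzRingType) (charR : q \in [pchar R]) i (x y : R) :
  GRing.comm x y -> (x - y) ^+ (q ^ i) = x ^+ (q ^ i) - y ^+ (q ^ i).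
Proof.
move=> cxy; elim: i => [|i IHi]; first by rewrite !expr1.
rewrite expnSr !exprM IHi; apply: (pFrobenius_autB_comm charR).
by apply/commrX/commr_sym/commrX/commr_sym.
Qed.

Lemma coef_frob_poly (q : nat) (R : comNzRingType) (charR : q \in [pchar R])
    i (p : {poly R}) j : (p ^+ (q ^ i))`_(j * q ^ i) = p`_j ^+ (q ^ i).
Proof.
have q0 : (0 < q ^ i)%N by rewrite expn_gt0 prime_gt0 // (pcharf_prime charR).
have charP : q \in [pchar {poly R}] by apply: (rmorph_pchar polyC).
rewrite -{1}[p]coefK poly_def frob_sum // coef_sum.
under eq_bigr do rewrite exprZn -exprM coefZ coefXn eqn_pmul2r //.
have [ltj|lej] := ltnP j (size p).
  rewrite (bigD1 (Ordinal ltj)) //= eqxx mulr1 big1 ?addr0 // => k.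
  by rewrite -val_eqE /= eq_sym => /negPf->; rewrite mulr0.
rewrite [p`_j]nth_default // expr0n gtn_eqF // big1 // => k _.
by rewrite gtn_eqF ?mulr0 // (leq_trans _ lej).
Qed.

(** In characteristic [q], [('X - M)^N = 'X^N - M^N]; take determinants. *)
Lemma char_poly_frob (q : nat) (F : fieldType) (charF : q \in [pchar F]) i m
    (M : 'M[F]_m.+1) j : (char_poly (M ^+ (q ^ i)))`_j = (char_poly M)`_j ^+ (q ^ i).
Proof.
set N := (q ^ i)%N.
have N0 : (0 < N)%N by rewrite expn_gt0 prime_gt0 // (pcharf_prime charF).
have charP : q \in [pchar {poly F}] by apply: (rmorph_pchar polyC).
have charM : q \in [pchar 'M[{poly F}]_m.+1] by apply: (rmorph_pchar (@scalar_mx _ m.+1)).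
rewrite -coef_frob_poly // -/N.
have detX (A : 'M[{poly F}]_m.+1) n : \det (A ^+ n) = \det A ^+ n.
  by elim: n => [|n IHn]; rewrite ?det1 // !exprS -IHn -det_mulmx.
rewrite /char_poly -detX /char_poly_mx frobB_comm //; last exact: comm_scalar_mx.
have -> : ('X%:M : 'M[{poly F}]_m.+1) ^+ (q ^ i) = ('X^N)%:M.
  by rewrite -(rmorphXn (@scalar_mx _ m.+1)).
have -> : map_mx polyC M ^+ (q ^ i) = map_mx polyC (M ^+ N).
  rewrite -/N; elim: {N0}N => [|n IHn]; first by rewrite !expr0 map_mx1.
  by rewrite !exprS IHn map_mxM.
have -> : ('X^N)%:M - map_mx polyC (M ^+ N) =
    map_mx (comp_poly 'X^N) ('X%:M - map_mx polyC (M ^+ N)).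
  rewrite rmorphB /= map_scalar_mx /= comp_polyX; congr (_ - _).
  by apply/matrixP => a b; rewrite !mxE comp_polyC.
rewrite det_map_mx coef_comp_poly_Xn // dvdn_mull //.
by rewrite mulnK.
Qed.

Lemma char_poly_denom (R : idomainType) m (M : 'M[{fraction R}]_m) (d : R) :
  (forall i j, in_ring (tofrac d * M i j)) ->
  forall k, in_ring (tofrac (d ^+ m) * (char_poly M)`_k).
Proof.
move=> dM k.
have /choice[N EN] : forall ij : 'I_m * 'I_m, exists a, tofrac d * M ij.1 ij.2 = tofrac a.
  by move=> ij; apply: dM.
pose A := (d%:P * 'X)%:M - \matrix_(i < m, j < m) (N (i, j))%:P.
exists (\det A)`_k.
suff E : map_poly (@tofrac R) (\det A) = (tofrac (d ^+ m))%:P * char_poly M.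
  by rewrite -coefCM -E coef_map.
rewrite -det_map_mx tofracXn rmorphXn /= -detZ; congr (\det _).
apply/matrixP => i j; rewrite !mxE rmorphB rmorphMn rmorphM /= map_polyX !map_polyC /=.
by rewrite mulrBr mulrnAr -polyCM -EN.
Qed.

(** Here [R] is the polynomial ring of a normalization, [L] a finite extension of
    its field of fractions and [rho] the regular representation. *)
Section Discreteness.
Variables (q : nat) (R : idomainType) (charR : q \in [pchar R]).
Hypothesis UR : frob_closed q R.
Variables (L : fieldType) (f : {rmorphism {fraction R} -> L}).
Variables (m : nat) (rho : {rmorphism L -> 'M[{fraction R}]_m.+1}).
Hypothesis rho_scalar : forall c, rho (f c) = c%:M.

Local Notation g := (f \o @tofrac R).

Lemma bounded_powers (b : L) : integralOver g b ->
  exists2 d : R, d != 0 & forall k i j, in_ring (tofrac d * rho (b ^+ k) i j).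
Proof.
move=> /(integral_powers (f := g))[n b_n].
have [||d d0 dn] := @common_multiple R n
    (fun k d => forall i j, in_ring (tofrac d * rho (b ^+ k) i j)).
- move=> k d e kd i j; rewrite tofracM mulrAC.
  by apply: in_ringM; [exact: kd | exact: in_ring_tofrac].
- move=> k _; have [d d0 dk] := common_denom (fun ij => rho (b ^+ k) ij.1 ij.2).
  by exists d => // i j; apply: (dk (i, j)).
exists d => // k.
pose J x := forall i j, in_ring (tofrac d * rho x i j).
apply: (@lspan_min _ _ g J _ _ _ _ _ _ (b_n k)) => [i j|x y Jx Jy i j|c x Jx i j|x].
- by rewrite rmorph0 mxE mulr0; apply: in_ring0.
- by rewrite rmorphD mxE mulrDr; apply: in_ringD.
- rewrite rmorphM /= rho_scalar -mulmxE mul_scalar_mx mxE mulrCA.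
  by apply: in_ringM; [exact: in_ring_tofrac | exact: Jx].
by move=> /mapP[j]; rewrite mem_iota => ltj ->; apply: dn.
Qed.

(** Let [n] be the size of the matrices, [a] a coefficient of the characteristic
    polynomial of [w], and [N = q^i]. A single [d] clears the denominators of the
    matrices of all powers of [c w^N], so that [d^n (c^n a^N)^N'] is in [R] for
    each power [N'] of [q]. Choosing [N'] for [d^n] gives that [c^n a^N] is in
    [R], and then [a] is in [R] if [N] was chosen for [c^n]. *)
Lemma frob_integral_coef (c : R) : c != 0 -> exists i0, forall i, (i0 <= i)%N ->
  forall w, integralOver g (g c * w ^+ (q ^ i)) ->
  forall k, in_ring (char_poly (rho w))`_k.
Proof.
move=> c0; have [i0 Ui0] := UR (expf_neq0 m.+1 c0).
exists i0 => i lei w cw_int k.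
have [d d0 dcw] := bounded_powers cw_int.
apply: (Ui0 i lei).
have [i1 Ui1] := UR (expf_neq0 m.+1 d0); apply: (Ui1 i1 (leqnn _)).
have charF : q \in [pchar {fraction R}] by apply: (rmorph_pchar (@tofrac R)).
set N1 := (q ^ i1)%N; rewrite exprMn -exprM -expnD -char_poly_frob // mulrA.
rewrite -tofracXn -tofracM -exprM mulnC exprM -exprMn.
apply: char_poly_denom => a b; have := dcw N1 a b.
rewrite exprMn -exprM -expnD rmorphM rmorphXn /= rho_scalar -(rmorphXn (@scalar_mx _ m.+1)) /=.
rewrite -mulmxE mul_scalar_mx mxE rmorphXn tofracM tofracXn mulrA.
by [].
Qed.

Lemma char_poly_annihilates (w : L) : root (map_poly f (char_poly (rho w))) w.
Proof.
apply/rootP/(fmorph_inj rho); rewrite rmorph0.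
rewrite -[RHS](Cayley_Hamilton (rho w)).
elim/poly_ind: (char_poly _) => [|p c IHp]; first by rewrite map_poly0 horner0 !rmorph0.
rewrite rmorphD rmorphM /= map_polyX map_polyC /= hornerMXaddC.
by rewrite !rmorphD !rmorphM /= IHp horner_mx_X horner_mx_C rho_scalar.
Qed.

Lemma monic_equation (w : L) :
  (forall k, in_ring (char_poly (rho w))`_k) ->
  exists p : {poly R}, [/\ p \is monic, size p = m.+2 & root (map_poly g p) w].
Proof.
move=> /choice[a Ea]; pose p := \poly_(k < m.+2) a k.
have Ep : map_poly (@tofrac R) p = char_poly (rho w).
  apply/polyP => j; rewrite coef_map coef_poly /=.
  have [ltj|lej] := ltnP j m.+2; first by rewrite -Ea.
  by rewrite rmorph0 nth_default // size_char_poly.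
exists p; split.
- have := char_poly_monic (rho w); rewrite !monicE -Ep.
  by rewrite (lead_coef_map_inj (@tofrac_inj R)) ?rmorph0 // -tofrac1 tofrac_eq.
- rewrite -(size_char_poly (rho w)) -Ep size_map_inj_poly ?rmorph0 //.
  exact: tofrac_inj.
by rewrite map_poly_comp /= Ep char_poly_annihilates.
Qed.

(** Take for [c] the lowest nonzero coefficient of an equation of [u], which [u]
    divides. *)
Lemma integral_divides_scalar (u : L) : u != 0 -> integralOver g u ->
  exists (c : R) (u' : L), [/\ c != 0, integralOver g u' & g c = u * u'].
Proof.
move=> u0 u_int; have [p p_mon p_u] := u_int.
elim/poly_ind: p {p_mon}(monic_neq0 p_mon) p_u => [|p c IHp]; first by rewrite eqxx.
rewrite rootE rmorphD rmorphM /= map_polyX map_polyC /= hornerMXaddC.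
have [->|c0] := eqVneq c 0.
  rewrite polyC0 addr0 tofrac0 rmorph0 addr0 => pX; rewrite mulf_eq0 (negPf u0) orbF => p_u.
  by apply: IHp => //; apply: contraNneq pX => ->; rewrite mul0r.
move=> _ /eqP E; exists c, (- (map_poly g p).[u]); split=> //.
  apply: integral_opp; apply: (integral_horner (RtoK := g)) => //.
  by apply/(integral_poly g) => i; rewrite coef_map; apply: (integral_id g).
by apply/eqP; rewrite -subr_eq0 mulrN opprK addrC mulrC E.
Qed.

(** The degree [m.+1] of the equations is the size of the matrices, and the
    exponent of the second part depends on [u] only: both are independent of
    [w]. *)
Lemma uniform_integrality :
  (forall w, integralOver g w ->
    exists p : {poly R}, [/\ p \is monic, size p = m.+2 & root (map_poly g p) w]) /\
  (forall u, u != 0 -> integralOver g u -> exists i, forall w,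
    integralOver g (u * w ^+ (q ^ i)) -> integralOver g w).
Proof.
split=> [w w_int|u u0 u_int].
  apply: monic_equation; have [i H] := frob_integral_coef (oner_neq0 R).
  apply: (H i (leqnn _)); apply: integral_mul; first exact: (integral_id g).
  exact: (subringX (subring_integral g)).
have [c [u' [c0 u'_int Ec]]] := integral_divides_scalar u0 u_int.
have [i H] := frob_integral_coef c0; exists i => w uw_int.
have [|p [p_mon _ p_w]] := monic_equation (H i (leqnn _) w _); last by exists p.
by rewrite Ec [u * u']mulrC -mulrA; apply: integral_mul.
Qed.
End Discreteness.

(** * Noether normalization *)
Lemma digits_inj r N (m m' : 'I_r -> nat) :
  (forall i, m i < N)%N -> (forall i, m' i < N)%N ->
  (\sum_i m i * N ^ i = \sum_i m' i * N ^ i)%N -> m =1 m'.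
Proof.
elim: r m m' => [|r IHr] m m' ltm ltm'; first by move=> _ [].
have N0 : (0 < N)%N by apply: leq_ltn_trans (ltm ord0).
have split_sum (d : 'I_r.+1 -> nat) : (\sum_i d i * N ^ i =
    (\sum_(i < r) d (lift ord0 i) * N ^ i) * N + d ord0)%N.
  rewrite big_ord_recl expn0 muln1 big_distrl addnC /=; congr addn.
  by apply: eq_bigr => i _; rewrite -mulnA -expnSr.
rewrite !split_sum => E.
have E0 : m ord0 = m' ord0.
  by move/(congr1 (modn^~ N)): E; rewrite !modnMDl !modn_small.
have E1 : forall i, m (lift ord0 i) = m' (lift ord0 i).
  apply: (IHr (fun i => m (lift ord0 i)) (fun i => m' (lift ord0 i))) => //.
  by move/eqP: E; rewrite E0 eqn_add2r eqn_pmul2r // => /eqP.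
by move=> i; have [j ->|->] := unliftP ord0 i.
Qed.

Section MonicSize.
Variable (K : comNzRingType).

Definition monic_size n (P : {poly K}) := P \is monic /\ size P = n.+1.

Lemma monic_size1 : monic_size 0 1.
Proof. by split; [exact: monic1 | rewrite size_poly1]. Qed.

Lemma monic_sizeM n n' P P' :
  monic_size n P -> monic_size n' P' -> monic_size (n + n') (P * P').
Proof.
move=> [mP sP] [mP' sP']; split; first by rewrite monicMl.
by rewrite size_monicM ?monic_neq0 // sP sP' addnS.
Qed.

Lemma monic_size_prod r (n : 'I_r -> nat) (F : 'I_r -> {poly K}) :
  (forall i, monic_size (n i) (F i)) -> monic_size (\sum_i n i) (\prod_i F i).
Proof.
by move=> nF; apply: (big_rec2 monic_size) => [|i d P _]; [exact: monic_size1 | exact: monic_sizeM].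
Qed.

Lemma monic_sizeX n e P : monic_size n P -> monic_size (e * n) (P ^+ e).
Proof.
move=> nP; elim: e => [|e IHe]; first exact: monic_size1.
by rewrite mulSn exprS; apply: monic_sizeM.
Qed.

Lemma monic_size_binomial c e : (0 < e)%N -> monic_size e (c%:P + 'X^e).
Proof.
move=> e0; have lt : (size c%:P < size ('X^e : {poly K}))%N.
  by rewrite size_polyXn (leq_ltn_trans (size_polyC_leq1 _)).
split; last by rewrite addrC size_polyDl // size_polyXn.
by rewrite monicE addrC lead_coefDl // lead_coefXn.
Qed.
End MonicSize.

Lemma subring_poly_integral (R K : comNzRingType) (f : {rmorphism R -> K}) :
  subring (fun P : {poly K} => forall i, integralOver f P`_i).
Proof.
split=> [i|P Q fP fQ i|P Q fP fQ i]; first by rewrite coef1; apply: integral_nat.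
  by rewrite coefB; apply: integral_sub.
rewrite coefM; apply: (subring_sum (subring_integral f)) => j _.
exact: integral_mul.
Qed.

Lemma exists_max (T : eqType) (s : seq T) (w : T -> nat) (x0 : T) : x0 \in s ->
  exists2 x, x \in s & forall y, y \in s -> (w y <= w x)%N.
Proof.
elim: s x0 => //= a s IHs _ _; case: s IHs => [|b s] IHs.
  by exists a; rewrite ?mem_head // => y; rewrite inE => /eqP->.
have [x sx maxx] := IHs b (mem_head _ _).
have [le|lt] := leqP (w a) (w x).
  exists x; first by rewrite inE sx orbT.
  by move=> y; rewrite inE => /predU1P[->|/maxx].
exists a; first by rewrite mem_head.
move=> y; rewrite inE => /predU1P[->//|/maxx le].
exact: leq_trans le (ltnW lt).
Qed.

Section NoetherNormalization.
Variables (k L : fieldType) (iota : {rmorphism k -> L}).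

(** Put [x = a ord0] and [c_i = a_i - x^(N^i)]. Substituting [c_i + T^(N^i)] for
    the variables turns each monomial of [p] into a monic polynomial in [T] over
    the ring of the [c_i], whose degree is the number with the exponents as its
    digits in base [N]. These degrees are distinct, so that the substitution in
    [p] has a constant leading coefficient; [x] is one of its roots. *)
Lemma nagata_trick r (a : 'I_r.+1 -> L) (p : {mpoly k[r.+1]}) :
  p != 0 -> mmap iota a p = 0 ->
  exists e : 'I_r.+1 -> nat, forall (R : comNzRingType) (f : {rmorphism R -> L}),
    (forall c, integralOver f (iota c)) ->
    (forall i, integralOver f (a (lift ord0 i) - a ord0 ^+ e (lift ord0 i))) ->
    integralOver f (a ord0).
Proof.
move=> p0 pa; pose N := msize p.
have ltN m i : m \in msupp p -> (m i < N)%N.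
  move=> mp; apply: leq_ltn_trans (msize_mdeg_lt mp).
  by rewrite mdegE (bigD1 i) //= leq_addr.
pose e (i : 'I_r.+1) := (N ^ i)%N.
exists e => R f iota_int c_int.
have N0 : (0 < N)%N by rewrite lt0n msize_poly_eq0.
pose c i := a i - a ord0 ^+ e i.
have cE i : integralOver f (c i).
  have [j ->|->] := unliftP ord0 i; first exact: c_int.
  by rewrite /c /e expn0 expr1 subrr; apply: integral0.
pose B (m : 'X_{1..r.+1}) : {poly L} := \prod_i ((c i)%:P + 'X^(e i)) ^+ m i.
pose wt (m : 'X_{1..r.+1}) := (\sum_i m i * e i)%N.
have B_mon m : monic_size (wt m) (B m).
  apply: monic_size_prod => i; apply: monic_sizeX; apply: monic_size_binomial.
  by rewrite expn_gt0 N0.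
pose G := \sum_(m <- msupp p) (iota p@_m)%:P * B m.
have Ga : G.[a ord0] = 0.
  rewrite -pa /G /mmap horner_sum; apply: eq_bigr => m _.
  rewrite hornerM hornerC; congr (_ * _); rewrite /B /mmap1 horner_prod.
  by apply: eq_bigr => i _; rewrite horner_exp hornerD hornerC hornerXn subrK.
have [m0 m0p maxm0] : exists2 m, m \in msupp p &
    forall m', m' \in msupp p -> (wt m' <= wt m)%N.
  by apply: (@exists_max _ _ wt (mlead p)); apply: mlead_supp.
have wt_inj m m' : m \in msupp p -> m' \in msupp p -> wt m = wt m' -> m = m'.
  move=> mp m'p /digits_inj E; apply/mnmP; apply: E => i; exact: ltN.
have sizeT m : (size ((iota p@_m)%:P * B m)%R <= (wt m).+1)%N.
  by have [_ <-] := B_mon m; rewrite mul_polyC size_scale_leq.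
have G_top : G`_(wt m0) = iota p@_m0.
  rewrite /G coef_sum (bigD1_seq m0) ?msupp_uniq //= big1_seq ?addr0.
    have [mon sz] := B_mon m0; rewrite coefCM -[wt m0]/((wt m0).+1.-1) -sz -lead_coefE.
    by rewrite (monicP mon) mulr1.
  move=> m /andP[nem mp]; apply: nth_default; apply: leq_trans (sizeT m) _.
  rewrite ltn_neqAle maxm0 // andbT; apply: contra nem => /eqP E.
  by rewrite (wt_inj m m0).
have sizeG : (size G <= (wt m0).+1)%N.
  rewrite /G big_seq; apply: (leq_trans (size_sum _ _ _)).
  by apply/bigmax_leqP_seq => m mp _; apply: leq_trans (sizeT m) _; rewrite ltnS maxm0.
have top0 : p@_m0 != 0 by rewrite -mcoeff_msupp.
pose G' := (iota (p@_m0)^-1)%:P * G.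
have G'_mon : G' \is monic.
  have leG' : (size G' <= (wt m0).+1)%N.
    by rewrite /G' mul_polyC (leq_trans (size_scale_leq _ _)).
  have topG' : G'`_(wt m0) = 1 by rewrite /G' coefCM G_top -rmorphM mulVf ?rmorph1.
  have szG' : size G' = (wt m0).+1.
    apply/eqP; rewrite eqn_leq leG' ltnNge; apply/negP => le.
    by move/eqP: topG'; rewrite nth_default // eq_sym oner_eq0.
  by rewrite monicE lead_coefE szG' /= topG'.
have G'_int : forall i, integralOver f G'`_i.
  have PR := subring_poly_integral f.
  have PC x : integralOver f x -> forall i, integralOver f (x%:P : {poly L})`_i.
    by move=> x_int i; rewrite coefC; case: ifP => // _; apply: integral0.
  apply: (subringM PR); first exact: PC.
  apply: (subring_sum PR) => m _; apply: (subringM PR); first exact: PC.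
  apply: (subring_prod PR) => i _; apply: (subringX PR); apply: (subringD PR).
    exact: PC.
  by move=> j; rewrite coefXn; apply: integral_nat.
apply: (@integral_root_monic _ _ f _ G') => //.
  by rewrite rootE /G' hornerM Ga mulr0.
exact/(integral_poly f).
Qed.

(** A relation between the generators makes one of them integral over [r]
    others, by [nagata_trick]. The change of variables by powers, instead of a
    linear one, is what makes this work over a finite field. *)
Theorem noether_normalization r (a : 'I_r -> L) :
  exists (d : nat) (y : 'I_d -> L), [/\ injective (mmap iota y),
    forall i, gen_ring (fun x => (exists c, x = iota c) \/ exists i, x = a i) (y i) &
    forall i, integralOver (mmap iota y) (a i)].
Proof.
elim: r a => [|r IHr] a.
  exists 0%N, a; split=> [p p'|[]//|[]//].
  rewrite -[p]mpolyKC -[p']mpolyKC !mmapC => /fmorph_inj E; congr mpolyC; exact: E.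
have [a_inj|] := pselect (injective (mmap iota a)).
  exists r.+1, a; split=> // [i|i]; first by apply: gen_ring_mem; right; exists i.
  by rewrite -(mmap1U a i) -(mmapX a iota); apply: (integral_id (mmap iota a)).
move=> not_inj; have [p [p0 pa]] : exists p, p != 0 /\ mmap iota a p = 0.
  apply: contrapT => nop; apply: not_inj => p p' E; apply/eqP; rewrite -subr_eq0.
  apply: contrapT => /negP pp'; apply: nop; exists (p - p'); split=> //.
  by rewrite rmorphB /= E subrr.
have [e eP] := nagata_trick p0 pa.
have [d [y [y_inj y_gen y_int]]] := IHr (fun i => a (lift ord0 i) - a ord0 ^+ e (lift ord0 i)).
exists d, y.
have int0 : integralOver (mmap iota y) (a ord0).
  by apply: eP => // c; rewrite -(mmapC y iota); apply: (integral_id (mmap iota y)).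
split=> // i.
  move=> S S_ring CS; apply: (y_gen i) => // x [[c ->]|[j ->]].
    by apply: CS; left; exists c.
  apply: subringB => //; last apply: subringX => //; apply: CS; right; by eexists.
have [j ->|->//] := unliftP ord0 i.
rewrite -(subrK (a ord0 ^+ e (lift ord0 j)) (a (lift ord0 j))).
apply: (integral_add (RtoK := mmap iota y)) => //.
exact: (subringX (subring_integral (mmap iota y))).
Qed.
End NoetherNormalization.

(** * Finiteness up to Frobenius *)
Lemma integral_trans (R A K : comNzRingType) (f : {rmorphism R -> A})
    (g : {rmorphism A -> K}) (z : K) :
  (forall a, integralOver f a) -> integralOver g z -> integralOver (g \o f) z.
Proof.
move=> f_int [p p_mon p_z].
apply: (@integral_root_monic _ _ (g \o f) z (map_poly g p)) => //.
  exact: monic_map.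
apply/(integral_poly (g \o f)) => i; rewrite coef_map.
exact: integral_rmorph.
Qed.

Definition quotients (K : fieldType) (S : K -> Prop) :=
  forall x, exists u v, [/\ S u, S v, v != 0 & x = u / v].

Lemma quotients_denom (K : fieldType) (S : K -> Prop) r (x : 'I_r -> K) :
  subring S -> quotients S ->
  exists d, [/\ S d, d != 0 & forall i, S (d * x i)].
Proof.
move=> S_ring Sq; have /choice[uv uvP] : forall i, exists uv : K * K,
    [/\ S uv.1, S uv.2, uv.2 != 0 & x i = uv.1 / uv.2].
  by move=> i; have [u [v uvP]] := Sq (x i); exists (u, v).
exists (\prod_i (uv i).2); split.
- by apply: subring_prod => // i _; have [] := uvP i.
- by rewrite prodf_seq_neq0; apply/allP => i _; have [] := uvP i.
move=> i; have [Su _ v0 ->] := uvP i; rewrite (bigD1 i) //= mulrC -!mulrA.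
rewrite [(uv i).2^-1 * _]mulrA mulVf // mul1r; apply: subringM => //.
by apply: subring_prod => // j _; have [] := uvP j.
Qed.

(** The inverse of an algebraic element is a polynomial in it, so that the ring
    generated by [s] over [F] is already a field. *)
Lemma finite_dimension (F L : fieldType) (f : {rmorphism F -> L}) (s : seq L) :
  (forall y, y \in s -> integralOver f y) ->
  quotients (gen_ring (fun y => (exists c, y = f c) \/ y \in s)) ->
  exists (m : nat) (h : 'I_m -> L), forall x, combination f h x.
Proof.
move=> s_int Sq; set S := gen_ring _ in Sq.
have S_ring : subring S by apply: gen_ring_subring.
have Sf c : S (f c) by apply: gen_ring_mem; left; exists c.
have [t St] := finite_span s_int.
exists (size t), (fun i => t`_i) => x; apply: lspan_ord; apply: St.
have [u [v [Su Sv _ ->]]] := Sq x; apply: (subringM S_ring) => //.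
apply: (inv_in_subring (f := f)) => //; apply: (Sv (integralOver f)); first exact: subring_integral.
by move=> y [[c ->]|/s_int//]; apply: integral_id.
Qed.

Section Conductor.
Variables (q : nat) (P : idomainType) (charP : q \in [pchar P]).
Hypothesis UP : frob_closed q P.
Variables (K : fieldType) (f : {rmorphism {fraction P} -> K}).
Variables (n : nat) (h : 'I_n -> K).
Hypothesis h_span : forall x, combination f h x.

Local Notation g := (f \o @tofrac P).

Let charF : q \in [pchar {fraction P}]. Proof. exact: (rmorph_pchar (@tofrac P)). Qed.
Let charK : q \in [pchar K]. Proof. exact: (rmorph_pchar f). Qed.
Let q1 : (1 < q)%N. Proof. by rewrite prime_gt1 // (pcharf_prime charP). Qed.

(** Among all [e], choose a family of [q^e]th powers with the least number of
    elements that spans all [q^e]th powers: it is a basis, and so is the family of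
    the [q]th powers of its elements, as it spans for [e.+1]. Frobenius is thus
    invertible on the subspace spanned by the [q^e]th powers, which it may fail to
    be on [K] itself when [K] is inseparable. *)
Lemma stable_frobenius_basis : exists (e r : nat) (x : 'I_r -> K),
  [/\ forall y, combination f (fun i => x i ^+ (q ^ e)) (y ^+ (q ^ e)),
      independent f (fun i => x i ^+ (q ^ e)) & independent f (fun i => x i ^+ (q ^ e.+1))].
Proof.
pose Q r := `[< exists e (x : 'I_r -> K),
  forall y, combination f (fun i => x i ^+ (q ^ e)) (y ^+ (q ^ e)) >].
have : exists r, Q r.
  exists n; apply/asboolP; exists 0%N, h => y; rewrite expr1.
  under eq_fun do rewrite expr1.
  exact: h_span.
case/ex_minnP => r /asboolP[e [x x_span]] minr; exists e, r, x.
have x_free e' : (forall y, combination f (fun i => x i ^+ (q ^ e')) (y ^+ (q ^ e'))) ->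
    independent f (fun i => x i ^+ (q ^ e')).
  move=> x_span' c cx i; apply: contrapT => /eqP ci.
  case: r x x_span minr x_span' c cx i ci => [|r] x x_span minr x_span' c cx i ci.
    by case: i ci.
  have : Q r.
    apply/asboolP; exists e', (fun k => x (lift i k)) => y.
    exact: combination_drop cx ci (x_span' y).
  by move=> /minr; rewrite ltnn.
split=> //; first exact: x_free.
apply: x_free => y; rewrite expnSr exprM; have [c ->] := x_span y.
exists (fun i => c i ^+ q); rewrite -[q in LHS]expn1 frob_sum //; apply: eq_bigr => i _.
by rewrite expn1 exprMn rmorphXn -exprM -expnSr.
Qed.

(** Let [eps] be the basis of [stable_frobenius_basis] and [V] the inverse of the
    matrix of Frobenius in it, with [c V] over [P]. If [d] clears the denominators
    of the coordinates of all powers of [b^(q^e)], going back from the power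
    [q^j] to the power [1] costs at most a factor [c^(q^j)] ([main]): for each
    coordinate [z] of [b^(q^e)], [d (c z)^(q^j)] is in [P] for all [j]. As [P] is
    [frob_closed], [c z] is in [P], and [c] is independent of [b]. *)
Lemma frobenius_conductor (S : K -> Prop) :
  subring S -> quotients S -> (forall p, S (g p)) ->
  exists (e : nat) (d : K), [/\ S d, d != 0 &
    forall b, integralOver g b -> S (d * b ^+ (q ^ e))].
Proof.
move=> S_ring Sq Sg; have [e [r [x [x_span x_free x_free']]]] := stable_frobenius_basis.
pose eps i := x i ^+ (q ^ e).
pose ev (z : 'rV[{fraction P}]_r) := \sum_i f (z 0 i) * eps i.
have ev_inj : injective ev.
  by move=> z z' /(free_inj x_free) E; apply/rowP.
have ev_surj y : exists z, ev z = y ^+ (q ^ e).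
  have [c ->] := x_span y; exists (\row_i c i).
  by apply: eq_bigr => i _; rewrite mxE.
(* The rows of the matrix [U] of Frobenius in the basis [eps]. *)
have /choice[u uE] : forall i, exists z, ev z = eps i ^+ q.
  by move=> i; have [z Ez] := ev_surj (x i ^+ q); exists z; rewrite Ez exprAC.
pose U := \matrix_(i, j) u i 0 j.
have evU (z : 'rV_r) : ev (z *m U) = \sum_i f (z 0 i) * eps i ^+ q.
  rewrite /ev; under eq_bigr => j _ do rewrite mxE rmorph_sum mulr_suml /=.
  rewrite exchange_big /=; apply: eq_bigr => i _.
  rewrite -uE /ev mulr_sumr; apply: eq_bigr => j _.
  by rewrite mxE rmorphM mulrA.
have U_unit : U \in unitmx.
  rewrite -row_free_unit; apply: inj_row_free => z zU; apply/rowP => i.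
  rewrite mxE; apply: (x_free' (fun i => z 0 i)).
  have ev0 : ev 0 = 0 by rewrite /ev big1 // => j _; rewrite mxE rmorph0 mul0r.
  rewrite -[RHS]ev0 -zU evU; apply: eq_bigr => j _; by rewrite /eps -exprM -expnSr.
pose V := invmx U.
have [c c0 cV] := common_denom (fun ij : 'I_r * 'I_r => V ij.1 ij.2).
have main j : forall z zz (d : P), ev zz = ev z ^+ (q ^ j) ->
    (forall i, in_ring (tofrac d * zz 0 i)) ->
    forall i, in_ring (tofrac (d * c ^+ (q ^ j)) * z 0 i ^+ (q ^ j)).
  elim: j => [|j IHj] z zz d.
    rewrite !expn0 !expr1 => /ev_inj-> dz i; rewrite mulrC tofracM mulrA [z 0 i * _]mulrC.
    by apply: in_ringM => //; apply: in_ring_tofrac.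
  move=> Ezz dzz i.
  pose zq : 'rV_r := \row_i z 0 i ^+ q.
  have Ezq : ev (zq *m U) = ev z ^+ q.
    rewrite evU -[q in RHS]expn1 frob_sum //; apply: eq_bigr => l _.
    by rewrite expn1 exprMn mxE rmorphXn.
  have := IHj (zq *m U) zz d; rewrite Ezq -exprM -expnS => /(_ Ezz dzz) IH.
  have -> : z 0 i ^+ (q ^ j.+1) = \sum_l ((zq *m U) 0 l) ^+ (q ^ j) * V l i ^+ (q ^ j).
    under eq_bigr do rewrite -exprMn.
    rewrite -frob_sum // expnS exprM; congr (_ ^+ _).
    by have := congr1 (fun w : 'rV_r => w 0 i) (mulmxK U_unit zq); rewrite !mxE => <-.
  rewrite mulr_sumr; apply: in_ring_sum => l _.
  (* One factor [c^(q^j)] clears the denominators of [V] and the other one comes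
     from the induction; as [q >= 2], both fit in [c^(q^j.+1)]. *)
  have le2 : (q ^ j + q ^ j <= q ^ j.+1)%N by rewrite addnn -mul2n expnS leq_mul2r q1 orbT.
  rewrite -(subnKC le2); set l' := (_ - _)%N.
  have -> : tofrac (d * c ^+ (q ^ j + q ^ j + l')) *
      ((zq *m U) 0 l ^+ (q ^ j) * V l i ^+ (q ^ j)) =
      tofrac (c ^+ l') * (tofrac (d * c ^+ (q ^ j)) * (zq *m U) 0 l ^+ (q ^ j)) *
      (tofrac c * V l i) ^+ (q ^ j).
    by rewrite !tofracM !tofracXn !exprD exprMn; ring.
  apply: in_ringM; last exact/in_ringX/(cV (l, i)).
  by apply: in_ringM => //; exact: in_ring_tofrac.
have [d' [Sd' d'0 Sd'eps]] := quotients_denom eps S_ring Sq.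
exists e, (g c * d'); split.
- exact: subringM.
- by rewrite mulf_neq0 // fmorph_eq0 tofrac_eq0.
move=> b b_int; set b1 := b ^+ (q ^ e).
have b1_int : integralOver g b1 by exact: (subringX (subring_integral g)).
have [l b1_l] := integral_powers (f := g) b1_int.
have b1_ev k : exists z, ev z = b1 ^+ k.
  by have [z Ez] := ev_surj (b ^+ k); exists z; rewrite Ez exprAC.
have [||d d0 dl] := @common_multiple P l
    (fun k d => exists z, ev z = b1 ^+ k /\ forall i, in_ring (tofrac d * z 0 i)).
- move=> k d a [z [Ez dz]]; exists z; split=> // i; rewrite tofracM mulrAC.
  by apply: in_ringM => //; exact: in_ring_tofrac.
- move=> k _; have [z Ez] := b1_ev k; have [d d0 dz] := common_denom (fun i => z 0 i).
  by exists d => //; exists z.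
have [z Ez] := b1_ev 1%N; rewrite expr1 in Ez.
have cz i : in_ring (tofrac c * z 0 i).
  have [j Uj] := UP d0; apply: (Uj j (leqnn _)).
  pose J y := exists zz, ev zz = y /\ forall i, in_ring (tofrac d * zz 0 i).
  have [||||zz [Ezz dzz]] := @lspan_min _ _ g J _ _ _ _ _ _ (b1_l (q ^ j)%N).
  - exists 0; split; first by rewrite /ev big1 // => a _; rewrite mxE rmorph0 mul0r.
    by move=> a; rewrite mxE mulr0; apply: in_ring0.
  - move=> _ _ [z1 [<- dz1]] [z2 [<- dz2]]; exists (z1 + z2); split.
      rewrite /ev -big_split; apply: eq_bigr => a _.
      by rewrite mxE rmorphD mulrDl.
    by move=> a; rewrite mxE mulrDr; apply: in_ringD.
  - move=> a _ [z1 [<- dz1]]; exists (tofrac a *: z1); split.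
      rewrite /ev mulr_sumr; apply: eq_bigr => k _.
      by rewrite mxE rmorphM mulrA.
    by move=> k; rewrite mxE mulrCA; apply: in_ringM => //; exact: in_ring_tofrac.
  - by move=> y /mapP[k]; rewrite mem_iota => ltk ->; apply: dl.
  rewrite exprMn mulrA -tofracXn -tofracM.
  by apply: (main j z zz d) => //; rewrite Ezz Ez.
rewrite -Ez /ev mulr_sumr; apply: subring_sum => // i _.
rewrite mulrACA /= -rmorphM; apply: subringM => //.
by have [a ->] := cz i; apply: Sg.
Qed.
End Conductor.

Lemma subring_in_ring (R : idomainType) : subring (@in_ring R).
Proof.
split=> [|x y Sx Sy|x y]; last exact: in_ringM.
  by rewrite -tofrac1; apply: in_ring_tofrac.
by apply: in_ringD => //; apply: in_ringN.
Qed.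

Lemma quotients_in_ring (R : idomainType) : quotients (@in_ring R).
Proof.
move=> x; have [a [b [b0 ->]]] := fracP x; exists (tofrac a), (tofrac b).
by split; rewrite ?tofrac_eq0 //; apply: in_ring_tofrac.
Qed.

Lemma lspan_map_mul (R K : comNzRingType) (f : {rmorphism R -> K}) (d : K)
    (s : seq K) x : lspan f [seq d * y | y <- s] x ->
  exists z, lspan f s z /\ x = d * z.
Proof.
elim: s x => [|y s IHs] x /=; first by move->; exists 0; rewrite mulr0.
move=> [a [u [/IHs[z [sz ->]] ->]]]; exists (f a * y + z); split; first by exists a, z.
by rewrite mulrDr mulrCA.
Qed.

Section FiniteUpToFrobenius.
Variables (q : nat) (P A : idomainType) (charP : q \in [pchar P]).
Hypothesis UP : frob_closed q P.
Variable g : {rmorphism P -> A}.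
Hypothesis A_int : forall a, integralOver g a.
Variable (s : seq A).
Hypothesis A_gen : forall a, gen_ring (fun x => (exists c, x = g c) \/ x \in s) a.
Hypothesis A_noeth : noetherian A.

(* The extension of [g] to the fields of fractions. *)
Variable f : {rmorphism {fraction P} -> {fraction A}}.
Hypothesis f_tofrac : forall p, f (tofrac p) = tofrac (g p).

Let integral_frac x : integral_closure A x -> integralOver (f \o @tofrac P) x.
Proof.
move=> /(integral_trans A_int)[p p_mon p_x]; exists p; first exact: p_mon.
have -> : map_poly (f \o @tofrac P) p = map_poly (@tofrac A \o g) p.
  by apply: eq_map_poly => c; exact: f_tofrac.
exact: p_x.
Qed.

Lemma fraction_finite_dimension :
  exists (m : nat) (h : 'I_m -> {fraction A}), forall x, combination f h x.
Proof.
apply: (@finite_dimension _ _ f (map (@tofrac A) s)).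
  move=> _ /mapP[a sa ->]; have [p p_mon p_a] := A_int a.
  exists (map_poly (@tofrac P) p); first exact: monic_map.
  have -> : map_poly f (map_poly (@tofrac P) p) = map_poly (@tofrac A) (map_poly g p).
    by rewrite -!map_poly_comp; apply: eq_map_poly => c; exact: f_tofrac.
  by rewrite rmorph_root.
set S := gen_ring _; have S_ring : subring S by apply: gen_ring_subring.
have SA a : S (tofrac a).
  apply: (@A_gen a (fun a => S (tofrac a))).
    split=> [|x y Sx Sy|x y Sx Sy]; first by rewrite tofrac1; apply: (subring1 S_ring).
      by rewrite tofracB; apply: (subringB S_ring).
    by rewrite tofracM; apply: (subringM S_ring).
  move=> x [[c ->]|sx]; apply: gen_ring_mem; last by right; apply: map_f.
  by left; exists (tofrac c); rewrite f_tofrac.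
move=> x; have [a [b [b0 ->]]] := fracP x; exists (tofrac a), (tofrac b).
by split=> //; rewrite tofrac_eq0.
Qed.

(** The conductor [d] embeds the [q^e]th powers of the elements of [X] into [A],
    by [y |-> d y^(q^e)]; [d] cancels from the relations that the noetherian
    property gives there. *)
Lemma finite_up_to_frobenius (X : set {fraction A}) : X `<=` integral_closure A ->
  exists (e : nat) (t : seq {fraction A}), (forall y, y \in t -> X y) /\
    forall y, X y -> lspan (@tofrac A) [seq z ^+ (q ^ e) | z <- t] (y ^+ (q ^ e)).
Proof.
move=> X_int; have [m [h h_span]] := fraction_finite_dimension.
have [|e [d [_ d0 dP]]] := frobenius_conductor charP UP h_span
  (@subring_in_ring A) (@quotients_in_ring A).
  by move=> p; rewrite /= f_tofrac; apply: in_ring_tofrac.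
pose phi y := d * y ^+ (q ^ e).
have [r [rX rspan]] := A_noeth (fun a => exists y, X y /\ tofrac a = phi y).
have [t [tX Et]] : exists t : seq {fraction A}, (forall y, y \in t -> X y) /\
    map (@tofrac A) r = map phi t.
  elim: r rX {rspan} => [|a r IHr] rX; first by exists [::].
  have [|t [tX Et]] := IHr; first by move=> y ry; apply: rX; rewrite inE ry orbT.
  have [|y [Xy Ey]] := rX a; first by rewrite mem_head.
  exists (y :: t); split; last by rewrite /= Et Ey.
  by move=> z; rewrite inE => /predU1P[->|/tX].
exists e, t; split=> // y Xy.
have [a Ea] := dP y (integral_frac (X_int y Xy)).
have ra : ideal_span r a by apply: rspan; exists y.
have : lspan (@tofrac A) (map (@tofrac A) r) (tofrac a).
  elim: (r) a ra {Ea} => [|z r' IHr] a /=; first by move->; rewrite tofrac0.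
  move=> [b [u [/IHr ru ->]]]; exists b, (tofrac u); split=> //.
  by rewrite tofracD tofracM.
rewrite Et -Ea /phi (map_comp ( *%R d) (fun y => y ^+ (q ^ e))).
move=> /lspan_map_mul[z [tz]].
by move=> /(mulfI d0) ->.
Qed.
End FiniteUpToFrobenius.

(** * Powers of an ideal *)
Section IdealPowers.
Variable K : comNzRingType.

Lemma expM_prod (M H : set K) (l : seq K) r h : size l = r ->
  (forall x, x \in l -> M x) -> H h -> ideal_expM M r H (\prod_(x <- l) x * h).
Proof.
move=> <- lM Hh; exists 1%N, (fun=> fun j => l`_j), (fun=> h).
split=> // [i j|]; first by apply: lM; apply: mem_nth.
by rewrite big_ord1 (big_nth 0) big_mkord.
Qed.

Lemma expM_ind (M H V : set K) r :
  V 0 -> (forall x y, V x -> V y -> V (x + y)) ->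
  (forall l h, size l = r -> (forall x, x \in l -> M x) -> H h ->
    V (\prod_(x <- l) x * h)) ->
  ideal_expM M r H `<=` V.
Proof.
move=> V0 VD VP _ [s [m [h [mM hH ->]]]]; apply: big_ind => // i _.
have -> : \prod_(j < r) m i j = \prod_(x <- codom (m i)) x.
  by rewrite /codom big_image.
apply: VP => //; first by rewrite size_codom card_ord.
by move=> x /codomP[j ->].
Qed.

Lemma expM0 (M H : set K) r : ideal_expM M r H 0.
Proof.
exists 0%N, (fun=> fun=> 0), (fun=> 0); split=> [[]//|[]//|].
by rewrite big_ord0.
Qed.

Lemma expMD (M H : set K) r x y :
  ideal_expM M r H x -> ideal_expM M r H y -> ideal_expM M r H (x + y).
Proof.
move=> [s [m [h [mM hH ->]]]] [s' [m' [h' [m'M h'H ->]]]].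
exists (s + s')%N, (fun i => match fintype.split i with inl j => m j | inr j => m' j end),
  (fun i => match fintype.split i with inl j => h j | inr j => h' j end).
split=> [i j|i|]; [by case: fintype.split | by case: fintype.split |].
rewrite big_split_ord /=; congr (_ + _); apply: eq_bigr => i _.
  case: fintype.splitP => j /=; first by move=> /ord_inj->.
  by move=> E; have := ltn_ord i; rewrite E ltnNge leq_addr.
case: fintype.splitP => j /=; first by move=> E; have := ltn_ord j; rewrite -E ltnNge leq_addr.
by move=> /addnI/ord_inj->.
Qed.

Lemma expM_sum (M H : set K) r (J : Type) (s : seq J) (Q : pred J) (F : J -> K) :
  (forall j, Q j -> ideal_expM M r H (F j)) ->
  ideal_expM M r H (\sum_(j <- s | Q j) F j).
Proof. by move=> FH; apply: big_ind => //; [exact: expM0 | exact: expMD]. Qed.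

Lemma expM_sub (M M' H : set K) r : M `<=` M' -> ideal_expM M r H `<=` ideal_expM M' r H.
Proof.
move=> MM'; apply: expM_ind => [|x y|l h szl lM Hh]; first exact: expM0.
  exact: expMD.
by apply: expM_prod => // x /lM/MM'.
Qed.

Lemma expM_mull (M H : set K) r b x : (forall h, H h -> H (b * h)) ->
  ideal_expM M r H x -> ideal_expM M r H (b * x).
Proof.
move=> bH; move: x; apply: expM_ind => [|x y|l h szl lM Hh] /=.
- by rewrite mulr0; apply: expM0.
- by rewrite mulrDr; apply: expMD.
by rewrite mulrCA; apply: expM_prod => //; apply: bH.
Qed.

Variables (B I : set K) (B_ring : subring B) (I_ideal : is_ideal B I).
Local Notation Ipow := (ideal_exp B I).

Let BI x : I x -> B x. Proof. exact: (ideal_sub I_ideal). Qed.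

Let Bprod (l : seq K) : (forall x, x \in l -> I x) -> B (\prod_(x <- l) x).
Proof.
move=> lI; rewrite big_seq; apply: (subring_prod B_ring) => x lx.
exact/BI/lI.
Qed.

Lemma Ipow_mull r b x : B b -> Ipow r x -> Ipow r (b * x).
Proof. by move=> Bb; apply: expM_mull => h; apply: (subringM B_ring). Qed.

Lemma IpowN r x : Ipow r x -> Ipow r (- x).
Proof.
rewrite -mulN1r; apply: Ipow_mull; apply: (subringN B_ring).
exact: (subring1 B_ring).
Qed.

Lemma IpowB r : Ipow r `<=` B.
Proof.
apply: expM_ind => [|x y|l h szl lI Bh]; first exact: (subring0 B_ring).
  exact: (subringD B_ring).
by apply: (subringM B_ring) => //; apply: Bprod.
Qed.

Lemma Ipow0 x : B x -> Ipow 0 x.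
Proof. by move=> Bx; rewrite -[x]mul1r -(big_nil 1 *%R xpredT id); apply: expM_prod. Qed.

Lemma Ipow1 x : I x -> Ipow 1 x.
Proof.
move=> Ix; rewrite -[x]mulr1 -(big_seq1 *%R x id); apply: expM_prod => //.
  by move=> y; rewrite inE => /eqP->.
exact: (subring1 B_ring).
Qed.

Lemma Ipow_leq r r' x : (r' <= r)%N -> Ipow r x -> Ipow r' x.
Proof.
move=> le; move: x; apply: expM_ind => [|x y|l h szl lI Bh] /=.
- exact: expM0.
- exact: expMD.
rewrite -(cat_take_drop r' l) big_cat -mulrA; apply: expM_prod.
- by rewrite size_takel // szl.
- by move=> x /mem_take/lI.
by apply: (subringM B_ring) => //; apply: Bprod => x /mem_drop/lI.
Qed.

Lemma IpowM r r' x y : Ipow r x -> Ipow r' y -> Ipow (r + r') (x * y).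
Proof.
move=> Ix; move: y; apply: expM_ind => [|y z|l' h' szl' l'I Bh'] /=.
- by rewrite mulr0; apply: expM0.
- by rewrite mulrDr; apply: expMD.
move: x Ix; apply: expM_ind => [|y z|l h szl lI Bh] /=.
- by rewrite mul0r; apply: expM0.
- by rewrite mulrDl; apply: expMD.
rewrite mulrACA -big_cat; apply: expM_prod; first by rewrite size_cat szl szl'.
  by move=> x; rewrite mem_cat => /orP[/lI|/l'I].
exact: (subringM B_ring).
Qed.
End IdealPowers.

(** * The extended Rees ring *)
Lemma clear_denominators (F : fieldType) (x y a b c : F) : a != 0 -> b != 0 ->
  x / a * (y / b) * (a * (b * c)) = x * c * y.
Proof. by move=> a0 b0; field; rewrite a0 b0. Qed.

Section ReesRing.
Variables (K : fieldType) (B I : set K) (B_ring : subring B) (I_ideal : is_ideal B I).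
Local Notation L := {fraction {poly K}}.
Local Notation Ipow := (ideal_exp B I).
Local Notation cst x := (tofrac (x%:P) : L).
Local Notation u := (tofrac 'X : L).

Let u0 : u != 0. Proof. by rewrite tofrac_eq0 polyX_eq0. Qed.

(** The extended Rees ring [B[I t, 1/t]] with [t = 1/u]: the coefficient of
    [u^i] in [p] is that of [t^(D - i)] in [x]. The truncated subtraction gives
    the ideal [B] in negative degrees of [t]. *)
Definition rees (x : L) := exists D (p : {poly K}),
  x = tofrac p / u ^+ D /\ forall i, Ipow (D - i) p`_i.

Let Ipow_mulX D (p : {poly K}) k i : (forall i, Ipow (D - i) p`_i) ->
  Ipow (D + k - i) (p * 'X^k)`_i.
Proof.
move=> pD; rewrite coefMXn; case: ltnP => le; first exact: expM0.
by apply: (Ipow_leq B_ring I_ideal) (pD _); lia.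
Qed.

Lemma rees_raise x : rees x -> exists D0, forall D, (D0 <= D)%N ->
  exists p : {poly K}, x = tofrac p / u ^+ D /\ forall i, Ipow (D - i) p`_i.
Proof.
move=> [D0 [p [-> pD]]]; exists D0 => D le; exists (p * 'X^(D - D0)); split.
  have -> : u ^+ D = u ^+ D0 * u ^+ (D - D0) by rewrite -exprD subnKC.
  rewrite tofracM tofracXn -mulf_div.
  by rewrite (divff (expf_neq0 (D - D0) u0)) mulr1.
by move=> i; rewrite -{1}(subnKC le); apply: Ipow_mulX.
Qed.

Lemma rees_subring : subring rees.
Proof.
split.
- exists 0%N, 1; split; first by rewrite tofrac1 expr0 divr1.
  move=> i; rewrite sub0n coef1; apply: Ipow0; case: (i == _).
    exact: (subring1 B_ring).
  exact: (subring0 B_ring).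
- move=> x y /rees_raise[D xD] /rees_raise[D' yD'].
  have [p [-> pD]] := xD (maxn D D') (leq_maxl _ _).
  have [r [-> rD]] := yD' (maxn D D') (leq_maxr _ _).
  exists (maxn D D'), (p - r); split; first by rewrite tofracB mulrBl.
  move=> i; rewrite coefB; apply: expMD; first exact: pD. exact: (IpowN B_ring (rD i)).
- move=> x y [D [p [-> pD]]] [D' [r [-> rD]]].
  exists (D + D')%N, (p * r); split; first by rewrite tofracM exprD mulf_div.
  move=> i; rewrite coefM; apply: expM_sum => j _.
  apply: (@Ipow_leq _ _ _ B_ring I_ideal (D - j + (D' - (i - j)))%N).
    by have := ltn_ord j; lia.
  exact: (IpowM B_ring).
Qed.

Lemma rees_cst b : B b -> rees (cst b).
Proof.
move=> Bb; exists 0%N, b%:P; split; first by rewrite expr0 divr1.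
move=> i; rewrite sub0n coefC; apply: Ipow0; case: (i == _) => //.
exact: (subring0 B_ring).
Qed.

Lemma rees_u : rees u.
Proof.
exists 0%N, 'X; split; first by rewrite expr0 divr1.
move=> i; rewrite sub0n coefX; apply: Ipow0; case: (i == _).
  exact: (subring1 B_ring).
exact: (subring0 B_ring).
Qed.

Lemma rees_ideal h : I h -> rees (cst h / u).
Proof.
move=> Ih; exists 1%N, h%:P; split=> // i; rewrite coefC.
case: i => [|i]; first exact: Ipow1.
exact: expM0.
Qed.

(** The condition in the definition of the integral closure of [I], with a
    prescribed degree [m]. *)
Definition equation_over m (g : K) := exists P : {poly K},
  [/\ P \is monic, size P = m.+1, root P g &
      forall j : nat, (1 <= j <= m)%N -> Ipow j P`_(m - j)].

(** The equation of [g t] has coefficients in the Rees ring; its homogeneous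
    component of degree [m] in [t] is an equation of [g], in which the
    coefficient of [g^(m - j)] is in [I^j]. *)
Lemma rees_equation (R : comNzRingType) (f : {rmorphism R -> L}) (p : {poly R}) m g :
  (forall c, rees (f c)) -> p \is monic -> size p = m.+1 ->
  root (map_poly f p) (cst g / u) -> equation_over m g.
Proof.
move=> f_rees p_mon szp /rootP p_g.
have [D Df] : exists D, forall j, (j < m.+1)%N -> exists P : {poly K},
    f p`_j = tofrac P / u ^+ D /\ forall i, Ipow (D - i) P`_i.
  have /choice[D0 D0P] : forall j, exists D0, forall D, (D0 <= D)%N ->
      exists P : {poly K}, f p`_j = tofrac P / u ^+ D /\ forall i, Ipow (D - i) P`_i.
    by move=> j; apply: rees_raise.
  exists (\max_(j < m.+1) D0 j) => j ltj; apply: D0P.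
  exact: (leq_bigmax (Ordinal ltj)).
have /choice[P PP] : forall j, exists P : {poly K}, (j < m.+1)%N ->
    f p`_j = tofrac P / u ^+ D /\ forall i, Ipow (D - i) P`_i.
  move=> j; case: (ltnP j m.+1) => [/Df[P PP]|_]; [by exists P | by exists 0].
(* The equation is multiplied by [u^(D + m)], so that the component of degree [m]
   in [t] becomes the coefficient of [u^D]. *)
pose c j := (P j * 'X^(m - j))`_D.
have cm : c m = 1.
  have [Em _] := PP m (leqnn _).
  have : f p`_m = 1.
    by rewrite -[m in p`_m]/(m.+1.-1) -szp -lead_coefE (monicP p_mon); exact: rmorph1.
  rewrite Em => /(canRL (divfK _)); rewrite expf_neq0 // mul1r -tofracXn.
  move=> /(_ isT)/tofrac_inj E.
  by rewrite /c subnn expr0 mulr1 E coefXn eqxx.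
have Ec : \sum_(j < m.+1) c j * g ^+ j = 0.
  have E0 : \sum_(j < m.+1) P j * 'X^(m - j) * (g ^+ j)%:P = 0 :> {poly K}.
    apply: (@tofrac_inj _); rewrite tofrac0 rmorph_sum /=.
    move/(congr1 ( *%R^~ (u ^+ D * u ^+ m))): p_g; rewrite mul0r => E0; rewrite -[RHS]E0.
    rewrite (@horner_coef_wide _ m.+1); last by rewrite -szp (size_poly _).
    rewrite mulr_suml; apply: eq_bigr => j _.
    have [Ej _] := PP j (ltn_ord j).
    have lej : (j <= m)%N by rewrite -ltnS.
    have -> : (map_poly f p)`_j = tofrac (P j) / u ^+ D by rewrite coef_map.
    have -> : u ^+ m = u ^+ j * u ^+ (m - j) by rewrite -exprD subnKC.
    rewrite !tofracM tofracXn polyC_exp tofracXn expr_div_n.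
        exact: esym (clear_denominators _ _ _ (expf_neq0 D u0) (expf_neq0 j u0)).
  have /(congr1 (fun r : {poly K} => r`_D)) := E0; rewrite coef0 coef_sum => E1.
  rewrite -[RHS]E1.
  by apply: eq_bigr => j _; rewrite coefMC.
exists (\poly_(j < m.+1) c j); split.
- by rewrite monicE lead_coef_poly // cm ?oner_neq0.
- by rewrite size_poly_eq // cm oner_neq0.
- by rewrite rootE horner_poly Ec.
move=> j /andP[j1 lej]; rewrite coef_poly ltnS leq_subr /c subKn // coefMXn.
case: ltnP => leD; first exact: expM0.
have [|_ PD] := PP (m - j)%N; first by rewrite ltnS leq_subr.
by have := PD (D - j)%N; rewrite subKn.
Qed.
End ReesRing.

Lemma common_denominator (F : fieldType) (x y a b : F) : a != 0 -> b != 0 -> y != 0 ->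
  x / y = b * (a * x) / (a * (b * y)).
Proof. by move=> a0 b0 y0; field; rewrite a0 b0 y0. Qed.

Lemma clear_constant_term (R : comNzRingType) (c d p v b a : R) : d * b = a ->
  c * d * (p * v + b) = d * (c * p) * v + c * a.
Proof. by move=> <-; ring. Qed.

Lemma subring_root (L : fieldType) (O : L -> Prop) N z : subring O ->
  (forall (p : {poly L}) z, p \is monic -> (forall i, O p`_i) -> root p z -> O z) ->
  (0 < N)%N -> O (z ^+ N) -> O z.
Proof.
move=> O_ring O_root N0 ON; apply: (O_root ('X^N - (z ^+ N)%:P)).
- by rewrite monicXnsubC.
- move=> i; rewrite coefB coefXn coefC; apply: (subringB O_ring).
    by case: (i == N); [apply: (subring1 O_ring) | apply: (subring0 O_ring)].
  by case: (i == 0%N); [exact: ON | exact: (subring0 O_ring)].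
by rewrite rootE hornerD hornerN hornerC hornerXn subrr.
Qed.

(** What the analysis of the filtration uses of the integral closure [O] of the
    Rees ring in [K(t)], with [u] in the role of [1/t]. *)
Record rees_closure (q : nat) (K L : fieldType) (cst : K -> L) (u : L)
    (B I : set K) (m : nat) (O : L -> Prop) : Prop := ReesClosure {
  rc_subring : subring O;
  rc_root : forall (p : {poly L}) z, p \is monic -> (forall i, O p`_i) ->
    root p z -> O z;
  rc_cst : forall b, B b -> O (cst b);
  rc_u : O u;
  rc_ideal : forall h, I h -> O (cst h / u);
  rc_equation : forall g, O (cst g / u) -> equation_over B I m g;
  rc_discrete : exists i, forall w, O (u * w ^+ (q ^ i)) -> O w
}.

Section ReesNormalization.
Variables (q : nat) (k : fieldType) (chark : q \in [pchar k]).
Variables (A : idomainType) (iota : {rmorphism k -> A}) (s : seq A).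
Hypothesis A_gen : forall a, gen_ring (fun x => (exists c, x = iota c) \/ x \in s) a.

Local Notation K := {fraction A}.
Local Notation B := (integral_closure A).
Local Notation L := {fraction {poly K}}.
Local Notation cst x := (tofrac (x%:P) : L).
Local Notation u := (tofrac 'X : L).

Let u0 : u != 0. Proof. by rewrite tofrac_eq0 polyX_eq0. Qed.

Lemma subring_closure : subring B.
Proof. exact: (subring_integral (@tofrac A)). Qed.

Lemma closure_tofrac a : B (tofrac a).
Proof. exact: (integral_id (@tofrac A)). Qed.

Variables (I : set K) (I_ideal : is_ideal B I).

Let kL : {rmorphism k -> L} := @tofrac _ \o @polyC _ \o @tofrac A \o iota.
Let toL : {rmorphism A -> L} := @tofrac _ \o @polyC _ \o @tofrac A.

(** [O] is the integral closure, in [K(t)], of a normalization of the ring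
    generated by [A], [u] and the [y/u] with [y] in [t]. It contains [h/u] for
    each [h] in [I], because it contains its [q^e]th power. The normalization is
    contained in the Rees ring, whence [rc_equation]. *)
Lemma exists_rees_closure e (t : seq K) :
  (forall y, y \in t -> I y) ->
  (forall y, I y -> lspan (@tofrac A) [seq z ^+ (q ^ e) | z <- t] (y ^+ (q ^ e))) ->
  exists m O, rees_closure q (@tofrac _ \o @polyC _) u B I m O.
Proof.
move=> tI I_t.
have charL : q \in [pchar L] by apply: (rmorph_pchar kL).
pose gens : seq L := map toL s ++ u :: [seq cst y / u | y <- t].
have [d [y [y_inj y_gen y_int]]] := noether_normalization kL (tnth (in_tuple gens)).
pose R : idomainType := {mpoly k[d]}.
have charR : q \in [pchar R] by apply: (rmorph_pchar (@mpolyC d k)).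
have UR : frob_closed q R by apply: frob_closed_mpoly.
have [f f_tofrac] : exists f : {rmorphism {fraction R} -> L},
    forall p, f (tofrac p) = mmap kL y p.
  by exists (frac_lift y_inj) => p; apply: frac_lift_tofrac.
pose g := f \o @tofrac R.
have gE p : g p = mmap kL y p by apply: f_tofrac.
pose O x := integralOver g x.
have O_ring : subring O by apply: (subring_integral g).
have O_gens x : x \in gens -> O x.
  move=> /(tnthP (in_tuple gens))[i ->]; have [p p_mon p_x] := y_int i.
  exists p; first exact: p_mon.
  have -> : map_poly g p = map_poly (mmap kL y) p by apply: eq_map_poly => c; exact: gE.
  exact: p_x.
have O_kL c : O (kL c).
  have -> : kL c = g c%:MP by rewrite gE mmapC.
  exact: (integral_id g).
pose S := gen_ring (fun x => (exists c, x = f c) \/ x \in gens).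
have S_ring : subring S by apply: gen_ring_subring.
have S_gens x : x \in gens -> S x by move=> gx; apply: gen_ring_mem; right.
have S_f c : S (f c) by apply: gen_ring_mem; left; exists c.
have gen_toL (T : L -> Prop) : subring T -> (forall c, T (kL c)) ->
    (forall x, x \in gens -> T x) -> forall a, T (toL a).
  move=> T_ring T_kL T_gens a; apply: (@A_gen a (fun a => T (toL a))).
    split=> [|a1 a2 T1 T2|a1 a2 T1 T2]; first by rewrite rmorph1; apply: subring1.
      by rewrite rmorphB; apply: subringB.
    by rewrite rmorphM; apply: subringM.
  move=> x [[c ->]|sx]; first exact: T_kL.
  by apply: T_gens; rewrite mem_cat; apply/orP; left; apply: map_f.
have S_kL c : S (kL c).
  have -> : kL c = f (tofrac c%:MP) by rewrite f_tofrac mmapC.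
  exact: S_f.
have S_A := gen_toL S S_ring S_kL S_gens.
have u_gens : u \in gens by rewrite mem_cat mem_head orbT.
have S_u := S_gens u u_gens.
have t_gens h : h \in t -> cst h / u \in gens.
  move=> th; rewrite mem_cat inE; apply/orP; right; apply/orP; right.
  exact: (map_f (fun z => cst z / u)).
have S_poly (p : {poly K}) : exists c : A, c != 0 /\ S (toL c * tofrac p).
  elim/poly_ind: p => [|p b [c [c0 Sc]]].
    by exists 1; rewrite oner_neq0 tofrac0 mulr0; split=> //; exact: (subring0 S_ring).
  have [x1 [x2 [x20 ->]]] := fracP b; exists (c * x2); split; first exact: mulf_neq0.
  have -> : toL (c * x2) * tofrac (p * 'X + (tofrac x1 / tofrac x2)%:P) =
      toL x2 * (toL c * tofrac p) * u + toL (c * x1).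
    have E : toL x2 * cst (tofrac x1 / tofrac x2) = toL x1.
      rewrite /toL /= -tofracM -polyCM; congr (tofrac _%:P).
      by rewrite mulrC divfK // tofrac_eq0.
    rewrite (rmorphM toL c x2) (rmorphM toL c x1) tofracD tofracM.
    exact: clear_constant_term E.
  apply: (subringD S_ring); last exact: S_A.
  by apply: (subringM S_ring) => //; apply: (subringM S_ring).
have S_quot : quotients S.
  move=> x; have [a [b [b0 ->]]] := fracP x.
  have [c [c0 Sca]] := S_poly a; have [c' [c'0 Scb]] := S_poly b.
  have toL0 v : v != 0 -> toL v != 0 by move=> v0; rewrite tofrac_eq0 polyC_eq0 tofrac_eq0.
  exists (toL c' * (toL c * tofrac a)), (toL c * (toL c' * tofrac b)).
  split; [exact: (subringM S_ring) | exact: (subringM S_ring) | |].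
    by rewrite !mulf_neq0 ?toL0 ?tofrac_eq0.
  have b'0 : tofrac b != 0 :> L by rewrite tofrac_eq0.
  exact: (common_denominator _ (toL0 c c0) (toL0 c' c'0) b'0).
have [n [h h_span]] : exists (n : nat) (h : 'I_n -> L), forall x, combination f h x.
  apply: (@finite_dimension _ _ f gens) => // x /O_gens[p p_mon p_x].
  exists (map_poly (@tofrac R) p); first exact: monic_map.
  by rewrite -map_poly_comp.
have [m [rho rho_scalar]] := regular_representation h_span.
have [uni disc] := uniform_integrality charR UR rho_scalar.
have O_root (p : {poly L}) z : p \is monic -> (forall i, O p`_i) -> root p z -> O z.
  move=> p_mon p_O p_z.
  exact: (@integral_root_monic _ _ g z p p_mon p_z (proj1 (integral_poly g p) p_O)).
have O_A := gen_toL O O_ring O_kL O_gens.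
have O_cst b : B b -> O (cst b).
  case=> p p_mon p_b.
  apply: (O_root (map_poly (@tofrac _ \o @polyC _) (map_poly (@tofrac A) p))).
  - by do 2!apply: monic_map.
  - by move=> i; rewrite !coef_map; apply: O_A.
  by rewrite -[cst b]/((@tofrac _ \o @polyC _) b) rmorph_root.
have O_u := O_gens u u_gens.
exists m.+1, O; split; [exact: O_ring | exact: O_root | exact: O_cst | exact: O_u | | |].
- move=> x Ix; set N := (q ^ e)%N.
  have N0 : (0 < N)%N by rewrite expn_gt0 prime_gt0 // (pcharf_prime chark).
  have ON : O ((cst x / u) ^+ N).
    pose J x := O (cst x / u ^+ N).
    have -> : (cst x / u) ^+ N = cst (x ^+ N) / u ^+ N.
      by rewrite expr_div_n polyC_exp tofracXn.
    apply: (@lspan_min _ _ (@tofrac A) J _ _ _ _ _ _ (I_t x Ix)) => [|v w Jv Jw|a v Jv|v].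
    - by rewrite /J polyC0 tofrac0 mul0r; apply: (subring0 O_ring).
    - rewrite /J polyCD tofracD mulrDl; exact: (subringD O_ring Jv Jw).
    - rewrite /J polyCM tofracM -mulrA; exact: (subringM O_ring (O_A a) Jv).
    move=> /mapP[w tw ->]; rewrite /J polyC_exp tofracXn -expr_div_n.
    by apply: (subringX O_ring); apply/O_gens/t_gens.
  exact: (subring_root O_ring O_root N0 ON).
- move=> x Ox; have [p [p_mon szp p_x]] := uni _ Ox.
  apply: (rees_equation subring_closure I_ideal (f := g) _ p_mon szp p_x) => c.
  have T_ring := rees_subring subring_closure I_ideal.
  have T_kL c' : rees B I (kL c') by apply/rees_cst/closure_tofrac/subring_closure.
  have T_gens v : v \in gens -> rees B I v.
    rewrite mem_cat => /orP[/mapP[a _ ->]|].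
      by apply/rees_cst/closure_tofrac/subring_closure.
    rewrite inE => /predU1P[->|/mapP[w tw ->]].
      exact: (rees_u I subring_closure).
    exact: (rees_ideal subring_closure (tI w tw)).
  change (rees B I (g c)); rewrite gE.
  apply: (subring_mpoly (g := mmap kL y) T_ring) => [c'|i].
    by rewrite /= mmapC; apply: T_kL.
  rewrite /= mmapX mmap1U; apply: (y_gen i) => // v [[c' ->]|[j ->]]; first exact: T_kL.
  by apply: T_gens; apply: mem_tnth.
exact: disc.
Qed.
End ReesNormalization.

(** * The filtration of the Qth-power algorithm *)
Lemma bernoulli a i : (a ^ i * (a + i) <= a * a.+1 ^ i)%N.
Proof.
elim: i => [|i IHi]; first by rewrite !expn0 addn0 mul1n muln1.
rewrite [in X in (_ <= X)%N]expnS mulnCA; apply: leq_trans (leq_mul (leqnn a.+1) IHi).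
by rewrite expnSr -mulnA [leqRHS]mulnCA leq_mul2l; apply/orP; right; nia.
Qed.

Lemma pow_ratio a N : (0 < a)%N -> exists i, (a ^ i * N <= a.+1 ^ i)%N.
Proof.
move=> a0; exists (N * a)%N; rewrite -(leq_pmul2l a0) mulnCA.
apply: leq_trans (bernoulli a (N * a)); rewrite leq_mul2l mulnC leq_addl orbT.
by [].
Qed.

Section QpowerClosure.
Variables (q : nat) (K L : fieldType) (charL : q \in [pchar L]).
Variables (cst : {rmorphism K -> L}) (u : L) (u0 : u != 0).
Variables (B : set K) (B_ring : subring B).
Hypothesis B_root : forall (p : {poly K}) z, p \is monic -> (forall i, B p`_i) ->
  root p z -> B z.
Variables (I : set K) (I_ideal : is_ideal B I) (m : nat) (O : L -> Prop).
Hypothesis IO : rees_closure q cst u B I m O.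
Let O_ring : subring O. Proof. exact: rc_subring IO. Qed.

Local Notation C := (ideal_integral_closure B).

(** [J] is [I] itself in [closureE], and [C(I)] in [closure_idem]. *)
Let O_power (J : set K) : (forall x, J x -> O (cst x / u)) ->
  forall j x, ideal_exp B J j x -> O (cst x / u ^+ j).
Proof.
move=> JO j; apply: expM_ind => [|x y Ox Oy|l h <- lJ Bh].
- by rewrite rmorph0 mul0r; exact: (subring0 O_ring).
- by rewrite rmorphD mulrDl; exact: (subringD O_ring Ox Oy).
elim: l lJ => [|x l IHl] lJ.
  by rewrite big_nil mul1r expr0 divr1; exact: (rc_cst IO Bh).
rewrite big_cons /= -mulrA rmorphM exprS -mulf_div.
apply: (subringM O_ring); first by apply: JO; apply: lJ; rewrite mem_head.
by apply: IHl => y ly; apply: lJ; rewrite inE ly orbT.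
Qed.

Lemma closure_rees (J : set K) : (forall x, J x -> O (cst x / u)) ->
  forall g, C J g -> O (cst g / u).
Proof.
move=> JO g [Bg [d [p [p_mon szp pB pJ /rootP p_g]]]].
pose P : {poly L} := \poly_(i < d.+1) (cst p`_i / u ^+ (d - i)).
have pd : p`_d = 1 by rewrite -[d in p`_d]/(d.+1.-1) -szp -lead_coefE (monicP p_mon).
have Pd : cst p`_d / u ^+ (d - d) = 1 by rewrite pd subnn expr0 divr1 rmorph1.
apply: (rc_root IO (p := P)).
- have ne : cst p`_d / u ^+ (d - d) != 0 by rewrite Pd oner_neq0.
  by apply/eqP; exact: (etrans (lead_coef_poly (ltn0Sn d) ne) Pd).
- move=> i; rewrite coef_poly; case: ltnP => [lei|_]; last exact: (subring0 O_ring).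
  rewrite ltnS leq_eqVlt in lei; case/predU1P: lei => [->|lti].
    by rewrite Pd; exact: (subring1 O_ring).
  apply: (O_power JO); have := pJ (d - i)%N; rewrite subn_gt0 lti leq_subr subKn; last exact: ltnW.
  by apply.
apply/rootP; rewrite horner_poly.
have -> : \sum_(i < d.+1) cst p`_i / u ^+ (d - i) * (cst g / u) ^+ i = cst p.[g] / u ^+ d.
  rewrite (@horner_coef_wide _ d.+1) ?szp // rmorph_sum.
  rewrite mulr_suml; apply: eq_bigr => i _; have lei : (i <= d)%N by rewrite -ltnS.
  by rewrite rmorphM rmorphXn expr_div_n mulf_div -exprD subnK.
by rewrite p_g rmorph0 mul0r.
Qed.

Lemma rees_equation_closure g : O (cst g / u) -> C I g.
Proof.
move=> /(rc_equation IO)[P [P_mon szP P_g PI]].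
have PB i : B P`_i.
  have [lti|] := ltnP i m.
    apply: (@IpowB _ _ _ B_ring I_ideal (m - i)%N).
    by have := PI (m - i)%N; rewrite subn_gt0 lti leq_subr subKn ?(ltnW lti) //; apply.
  rewrite leq_eqVlt => /predU1P[<-|ltm].
    have -> : P`_m = 1 by rewrite -[m in P`_m]/(m.+1.-1) -szP -lead_coefE (monicP P_mon).
    exact: (subring1 B_ring).
  by rewrite nth_default ?szP //; exact: (subring0 B_ring).
split; last by exists m, P.
exact: B_root P_mon PB P_g.
Qed.

Lemma closureE g : C I g <-> O (cst g / u).
Proof.
split; last exact: rees_equation_closure.
by apply: closure_rees; exact: (rc_ideal IO).
Qed.

Lemma closure_idem : C (C I) = C I.
Proof.
apply/seteqP; split=> g.
  by move=> /(closure_rees (fun x => proj1 (closureE x)))/closureE.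
move=> Cg; have [Bg _] := Cg; split=> //; exists 1%N, ('X - g%:P).
have cE i : ('X - g%:P)`_i = (i == 1%N)%:R - (if i == 0%N then g else 0).
  by rewrite coefB coefX coefC.
split; [exact: monicXsubC | exact: size_XsubC | | | by rewrite root_XsubC].
  move=> i; rewrite cE; apply: (subringB B_ring).
    by case: (i == 1%N); [exact: (subring1 B_ring) | exact: (subring0 B_ring)].
  by case: (i == 0%N) => //; exact: (subring0 B_ring).
move=> j; rewrite -eqn_leq => /eqP <-; rewrite cE subnn /= sub0r; apply: (IpowN B_ring).
exact: (Ipow1 B_ring).
Qed.

Lemma closure_ideal : is_ideal B (C I).
Proof.
split=> [g []//| |x y /closureE Ox /closureE Oy|b x Bb /closureE Ox]; apply/closureE || idtac.
- by rewrite rmorph0 mul0r; exact: (subring0 O_ring).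
- by rewrite rmorphD mulrDl; exact: (subringD O_ring Ox Oy).
- by rewrite rmorphM -mulrA; exact: (subringM O_ring (rc_cst IO Bb) Ox).
Qed.

Lemma ideal_sub_closure : I `<=` C I.
Proof. by move=> x /(rc_ideal IO)/closureE. Qed.

(** The equation of degree [m] writes [g^Q] as a sum of products of an element of
    [I^j], [j > 0], and [g^(Q - j)]. One of the [j] factors in [I] is kept apart,
    and the other [Q - 1] factors are in [C(I)]. *)
Lemma closure_reduction Q g : (m <= Q)%N -> (0 < Q)%N -> C I g ->
  ideal_expM (C I) (Q - 1) I (g ^+ Q).
Proof.
move=> leQ Q0 Cg; have /closureE/(rc_equation IO)[P [P_mon szP /rootP P_g PI]] := Cg.
have Em : g ^+ m = \sum_(i < m) -1 * (P`_i * g ^+ i).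
  move: P_g; rewrite (@horner_coef_wide _ m.+1) ?szP // big_ord_recr /=.
  have -> : P`_m = 1 by rewrite -[m in P`_m]/(m.+1.-1) -szP -lead_coefE (monicP P_mon).
  rewrite mul1r addrC => /eqP; rewrite addr_eq0 => /eqP->; rewrite -sumrN.
  by apply: eq_bigr => i _; rewrite mulN1r.
rewrite -(subnK leQ) exprD Em mulr_sumr; apply: expM_sum => i _.
have BN1 : B (-1) by apply: (subringN B_ring); exact: (subring1 B_ring).
rewrite mulrCA; apply: expM_mull; first by move=> h; apply: (ideal_mull I_ideal).
rewrite mulrCA -exprD subnK //.
have := PI (m - i)%N; rewrite subn_gt0 ltn_ord leq_subr subKn; last exact: ltnW.
move=> /(_ isT); move: (P`_i); apply: expM_ind => [|x y Vx Vy|l h szl lI Bh].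
- by rewrite mul0r; exact: expM0.
- by rewrite mulrDl; exact: expMD.
case: l szl lI => [|y l] szl lI.
  by have := ltn_ord i; rewrite -subn_gt0 -szl.
have -> : \prod_(x <- y :: l) x * h * g ^+ (Q - m + i)%N =
    \prod_(x <- l ++ nseq (Q - m + i)%N g) x * (h * y).
  by rewrite big_cons big_cat /= big_nseq iter_mulr_1; ring.
apply: expM_prod.
- by rewrite size_cat size_nseq; move: szl (ltn_ord i) => /=; lia.
- move=> x; rewrite mem_cat => /orP[lx|/nseqP[-> _]//].
  by apply: ideal_sub_closure; apply: lI; rewrite inE lx orbT.
by apply: (ideal_mull I_ideal) => //; apply: lI; rewrite mem_head.
Qed.
Section Filtration.
Variables (e : nat).
Hypothesis Q0 : (0 < q ^ e)%N.
Local Notation Q := (q ^ e)%N.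
Local Notation M := (Qpower_seq B Q I).

(** For a valuation [v], nonnegative on [O], with [v(u) = 1], this implies that
    [v(M_i) >= 1 - ((Q-1)/Q)^i]. Indeed [v >= 1] on [I], so that
    [Q v(M_(i+1)) >= (Q-1) v(M_i) + 1]. *)
Lemma Qpower_seq_rees i g : M i g ->
  O ((cst g / u) ^+ (Q ^ i) * u ^+ ((Q - 1) ^ i)).
Proof.
elim: i g => [|i IHi] g.
  by move=> Bg; rewrite !expn0 !expr1 divfK //; exact: (rc_cst IO).
set N := (Q ^ i)%N in IHi *; set E := ((Q - 1) ^ i)%N in IHi *.
have N0 : (0 < N)%N by rewrite expn_gt0 Q0.
case=> _; rewrite expnS expnSr exprM expr_div_n -rmorphXn /=; move: (g ^+ Q) => {g}.
apply: expM_ind => [|x y Ox Oy|l h szl lM Ih].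
- by rewrite rmorph0 mul0r expr0n gtn_eqF // mul0r; exact: (subring0 O_ring).
- rewrite /N -expnM rmorphD mulrDl frobD // mulrDl.
  by rewrite expnM; exact: (subringD O_ring Ox Oy).
have Ol : O ((cst (\prod_(x <- l) x) / u ^+ size l) ^+ N * u ^+ (E * size l)).
  elim: l lM {szl} => [|x l IHl] lM.
    by rewrite big_nil rmorph1 divr1 expr1n muln0 mul1r; exact: (subring1 O_ring).
  rewrite big_cons rmorphM /= exprS -mulf_div exprMn mulnS exprD mulrACA.
  apply: (subringM O_ring); first by apply: IHi; apply: lM; rewrite mem_head.
  by apply: IHl => y ly; apply: lM; rewrite inE ly orbT.
rewrite szl in Ol.
have -> : (cst (\prod_(x <- l) x * h) / u ^+ Q) ^+ N * u ^+ (E * (Q - 1)) =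
    (cst (\prod_(x <- l) x) / u ^+ (Q - 1)) ^+ N * u ^+ (E * (Q - 1)) * (cst h / u) ^+ N.
  by rewrite rmorphM -{1}(subnK Q0) exprD expr1 -mulf_div exprMn mulrAC.
apply: (subringM O_ring Ol); apply: (subringX O_ring); exact: (rc_ideal IO).
Qed.

Lemma closure_sub_Qpower_seq i : (m <= Q)%N -> C I `<=` M i.
Proof.
move=> leQ; elim: i => [|i IHi] g Cg; first by case: Cg.
split; first exact: IHi.
by apply: (expM_sub IHi); apply: closure_reduction.
Qed.

Lemma Qpower_seq_decreasing i j : (i <= j)%N -> M j `<=` M i.
Proof.
elim: j => [|j IHj]; first by rewrite leqn0 => /eqP->.
by rewrite leq_eqVlt => /predU1P[->//|/IHj sub] g [/sub].
Qed.

(** Take [i] with [(Q-1)^i / Q^i <= 1 / q^i0] and write [Q^i = q^i0 N]. Then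
    [(u (g t)^(q^i0))^N] is in [O] by [Qpower_seq_rees], hence so is its [N]th
    root, and [q^i0] is the exponent of [rc_discrete]. *)
Lemma Qpower_seq_sub_closure : (1 < q)%N -> (0 < e)%N -> exists i, M i `<=` C I.
Proof.
move=> q1 e0; have [i0 disc] := rc_discrete IO.
have Q1 : (1 < Q)%N by rewrite -(expn0 q) ltn_exp2l.
have [i1 lei1] : exists i, ((Q - 1) ^ i * q ^ i0 <= Q ^ i)%N.
  have [|i lei] := @pow_ratio (Q - 1) (q ^ i0); first by rewrite subn_gt0.
  by exists i; move: lei; rewrite subn1 prednK.
exists i1 => g Mg; apply/closureE/disc.
have le0 : (i0 <= e * i1)%N.
  rewrite -(leq_exp2l _ _ q1) expnM; apply: leq_trans lei1.
  by rewrite leq_pmull // expn_gt0 subn_gt0 Q1.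
have EQ : (Q ^ i1 = q ^ i0 * q ^ (e * i1 - i0))%N by rewrite -expnM -expnD subnKC.
set N := (q ^ (e * i1 - i0))%N in EQ.
have N0 : (0 < N)%N by rewrite expn_gt0 ltnW.
have leN : ((Q - 1) ^ i1 <= N)%N.
  by move: lei1; rewrite EQ mulnC leq_pmul2l // expn_gt0 ltnW.
apply: (subring_root O_ring (rc_root IO) N0).
rewrite exprMn -exprM -EQ mulrC -(subnKC leN) exprD mulrA.
apply: (subringM O_ring); last exact: (subringX O_ring _ (rc_u IO)).
exact: Qpower_seq_rees.
Qed.

Theorem Qpower_closure : (1 < q)%N -> (0 < e)%N -> (m <= Q)%N -> Qpower B Q I = C I.
Proof.
move=> q1 e0 leQ; have [i1 Mi1] := Qpower_seq_sub_closure q1 e0.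
have ME i : (i1 <= i)%N -> M i = C I.
  move=> lei; apply/seteqP; split; last exact: closure_sub_Qpower_seq.
  exact: subset_trans (Qpower_seq_decreasing lei) Mi1.
apply/seteqP; split=> g.
  move=> [l [El Mg]]; have Ml j : M (l + j)%N = M l.
    elim: j => [|j IHj]; first by rewrite addn0.
    by rewrite addnS /= IHj [RHS]El.
  by rewrite -(ME (l + i1)%N) ?leq_addl // Ml.
move=> Cg; exists i1; split; first by rewrite !ME.
by rewrite ME.
Qed.
End Filtration.
End QpowerClosure.

(** * Affine domains *)
Section AffineDomain.
Variables (q : nat) (k : fieldType) (chark : q \in [pchar k]) (n m : nat).
Variables (A : idomainType) (pi : {rmorphism {mpoly {mpoly k[n]}[m]} -> A}).
Hypothesis pi_surj : forall a : A, exists r, pi r = a.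

Let incl : {rmorphism {mpoly k[n]} -> A} := pi \o @mpolyC m _.
Let iota : {rmorphism k -> A} := incl \o @mpolyC n k.

Hypothesis incl_inj : injective incl.
Hypothesis A_int : forall a : A, integralOver incl a.

Definition generators : seq A :=
  [seq pi ('X_i)%:MP | i <- enum 'I_n] ++ [seq pi 'X_j | j <- enum 'I_m].

Lemma affine_gen a : gen_ring (fun x => (exists c, x = iota c) \/ x \in generators) a.
Proof.
have [r <-] := pi_surj a; set S := gen_ring _.
have S_ring : subring S by apply: gen_ring_subring.
apply: (subring_mpoly (g := pi) S_ring) => [c|j].
  apply: (subring_mpoly (g := incl) S_ring) => [c'|i].
    by apply: gen_ring_mem; left; exists c'.
  apply: gen_ring_mem; right; rewrite mem_cat; apply/orP; left.
  by apply: (map_f (fun i => pi ('X_i)%:MP)); rewrite mem_enum.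
apply: gen_ring_mem; right; rewrite mem_cat; apply/orP; right.
by apply: (map_f (fun i => pi 'X_i)); rewrite mem_enum.
Qed.

Lemma affine_noetherian : noetherian A.
Proof.
apply: (@noetherian_image _ _ pi) => //; [exact: rmorphD | exact: rmorphM | exact: rmorph0 |].
exact/noetherian_mpoly/noetherian_mpoly/noetherian_field.
Qed.

Local Notation K := {fraction A}.
Local Notation B := (integral_closure A).

Lemma affine_rees_closure (I : set K) : is_ideal B I -> exists m0 O,
  rees_closure q (@tofrac _ \o @polyC _) (tofrac 'X : {fraction {poly K}}) B I m0 O.
Proof.
move=> I_ideal; have charP : q \in [pchar {mpoly k[n]}].
  exact: (rmorph_pchar (@mpolyC n k)).
have tincl_inj : injective (@tofrac A \o incl) by exact: inj_comp (@tofrac_inj A) incl_inj.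
have [f f_tofrac] : exists f : {rmorphism {fraction {mpoly k[n]}} -> K},
    forall p, f (tofrac p) = tofrac (incl p).
  by exists (frac_lift tincl_inj) => p; apply: frac_lift_tofrac.
have A_gen a : gen_ring (fun x => (exists c, x = incl c) \/ x \in generators) a.
  move=> S S_ring CS; apply: (@affine_gen a S S_ring) => x [[c ->]|gx]; apply: CS.
    by left; exists c%:MP.
  by right.
have [e [t [tI I_t]]] := finite_up_to_frobenius charP (frob_closed_mpoly (n := n) chark)
  A_int A_gen affine_noetherian f_tofrac (ideal_sub I_ideal).
exact: (exists_rees_closure chark affine_gen I_ideal tI I_t).
Qed.

Lemma closure_root (p : {poly K}) z : p \is monic -> (forall i, B p`_i) ->
  root p z -> B z.
Proof.
move=> p_mon pB p_z.
exact: (@integral_root_monic _ _ (@tofrac A) z p p_mon p_z (proj1 (integral_poly _ p) pB)).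
Qed.

(** The bound on [e] takes into account both [I] and [C(I)], whose Rees rings have
    their own normalizations. *)
Theorem Qpower_stable_closure (I : set K) : is_ideal B I ->
  exists e0 : nat, forall e, (e0 <= e)%N ->
  let phi := Qpower B (q ^ e)%N in
  [/\ phi I = ideal_integral_closure B I, phi (phi I) = phi I & I `<=` phi I].
Proof.
move=> I_ideal; have [m1 [O1 IO1]] := affine_rees_closure I_ideal.
have charL : q \in [pchar {fraction {poly K}}].
  by apply: (rmorph_pchar (@tofrac _ \o @polyC _ \o @tofrac A \o iota)).
have u0 : (tofrac 'X : {fraction {poly K}}) != 0 by rewrite tofrac_eq0 polyX_eq0.
have B_ring : subring B by exact: subring_closure.
have C_ideal := closure_ideal B_ring closure_root I_ideal IO1.
have [m2 [O2 IO2]] := affine_rees_closure C_ideal.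
have q1 : (1 < q)%N by rewrite prime_gt1 // (pcharf_prime chark).
have pow_gt m0 e : (maxn 1 (maxn m1 m2) <= e)%N -> (m0 <= maxn m1 m2)%N -> (m0 <= q ^ e)%N.
  rewrite geq_max => /andP[_ le] le0; apply: leq_trans le0 _; apply: leq_trans le _.
  exact: ltnW (ltn_expl _ q1).
exists (maxn 1 (maxn m1 m2)) => e lee phi.
have e0 : (0 < e)%N by apply: leq_trans lee; rewrite leq_maxl.
have Q0 : (0 < q ^ e)%N by rewrite expn_gt0 ltnW.
have E1 : phi I = ideal_integral_closure B I.
  apply: (Qpower_closure charL u0 B_ring closure_root I_ideal IO1) => //.
  by apply: pow_gt; rewrite ?leq_maxl.
have E2 : phi (ideal_integral_closure B I) = ideal_integral_closure B I.
  rewrite -[RHS](closure_idem B_ring closure_root I_ideal IO1).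
  apply: (Qpower_closure charL u0 B_ring closure_root C_ideal IO2) => //.
  by apply: pow_gt; rewrite ?leq_maxr.
split; rewrite ?E1 ?E2 //; exact: (ideal_sub_closure B_ring closure_root I_ideal IO1).
Qed.
End AffineDomain.

Theorem theorem4 (q : nat) (q_prime : prime q) (n m : nat) (A : idomainType)
    (pi : {rmorphism {mpoly {mpoly 'F_q[n]}[m]} -> A})
    (pi_surj : forall a : A, exists r, pi r = a)
    (P_inj : injective (fun p : {mpoly 'F_q[n]} => pi p%:MP))
    (A_int : forall a : A,
       integralOver (fun p : {mpoly 'F_q[n]} => pi p%:MP) a)
    (I : set {fraction A}) (I_ideal : is_ideal (integral_closure A) I) :
  exists e0 : nat, forall e : nat, (e0 <= e)%N ->
    let phi := Qpower (integral_closure A) (q ^ e)%N in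
    exists k : nat,
      [/\ (1 <= k)%N,
          forall i : nat, (i < k)%N -> iter i phi I `<=` iter i.+1 phi I,
          iter k phi I = iter k.+1 phi I
        & iter k.+1 phi I =
          ideal_integral_closure (integral_closure A) I].
Proof.
have [e0 e0P] := Qpower_stable_closure (pchar_Fp q_prime) pi_surj P_inj A_int I_ideal.
exists e0 => e /e0P[E1 E2 Iphi] phi; exists 1%N.
rewrite -/phi in E1 E2 Iphi; split=> //=; rewrite ?E2 //.
by case=> // _; exact: Iphi.
Qed.
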